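(* There exist absolute constants $c_1,c_2>0$ and, for every $0<\alpha<1$, a constant $c_0(\alpha)$ such that the following holds. Let $X$ be a symmetric, non-degenerate, log-concave random vector in $\mathbb{R}^n$. Let $0<\alpha<1$, $N\ge c_0(\alpha)n$, $p=\alpha\log(eN/n)$, and let $X_1,\dots,X_N$ be independent copies of $X$. Then with probability at least $1-2\exp(-c_1N^{1-\alpha}n^\alpha)$, $$\mathrm{absconv}(X_1,\dots,X_N)\supset c_2\,Z_p(X).$$
   Context: A random vector in $\mathbb{R}^n$ is log-concave if it has a density $f$ such that for all $x,y$ in its support and all $0<\lambda<1$, $f(\lambda x+(1-\lambda)y)\ge f(x)^\lambda f(y)^{1-\lambda}$. It is non-degenerate if its support is not contained in a proper subspace of $\mathbb{R}^n$, and symmetric if $X$ and $-X$ have the same distribution. For $p\ge1$, $B(L_p(X))=\{t\in\mathbb{R}^n:(\mathbb{E}|\langle X,t\rangle|^p)^{1/p}\le1\}$, and the $L_p$-centroid body is its polar, $Z_p(X)=B(L_p(X))^\circ$, where $T^\circ=\{x\in\mathbb{R}^n:\langle t,x\rangle\le1\ \forall t\in T\}$. $\mathrm{absconv}(X_1,\dots,X_N)$ is the convex hull of $\pm X_1,\dots,\pm X_N$. $\log$ is the natural logarithm. *)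

(* Defs.v *)
From HB Require Import structures.
From mathcomp Require Import all_boot all_order all_algebra.
From mathcomp Require Import all_classical all_reals all_analysis.

Set Implicit Arguments.
Unset Strict Implicit.
Unset Printing Implicit Defensive.

Import Order.TTheory GRing.Theory Num.Theory.
Import numFieldTopology.Exports numFieldNormedType.Exports.

Local Open Scope classical_set_scope.
Local Open Scope ring_scope.

(* 'rV[R]_n carries the product sigma-algebra, generated by the coordinates
   (it is the Borel sigma-algebra). *)
Definition rV_display : measure_display. Proof. exact: default_measure_display. Qed.

Section measurable_rV.
Context {R : realType} {n : nat}.

Definition rV_coord (i : 'I_n) (v : 'rV[R]_n) : measurableTypeR R := v ord0 i.

Let rV_set0 : g_sigma_preimage rV_coord set0.
Proof. exact: sigma_algebra0. Qed.

Let rV_setC A : g_sigma_preimage rV_coord A -> g_sigma_preimage rV_coord (~` A).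
Proof. exact: sigma_algebraC. Qed.

Let rV_bigcup (F : (set 'rV[R]_n)^nat) :
  (forall i, g_sigma_preimage rV_coord (F i)) ->
  g_sigma_preimage rV_coord (\bigcup_i (F i)).
Proof. exact: sigma_algebra_bigcup. Qed.

HB.instance Definition _ := @isMeasurable.Build rV_display
  'rV[R]_n (g_sigma_preimage rV_coord) rV_set0 rV_setC rV_bigcup.

End measurable_rV.

Lemma measurable_rV_coord (R : realType) n (i : 'I_n) :
  measurable_fun [set: 'rV[R]_n] (rV_coord i).
Proof.
move=> _ Y mY; rewrite setTI; apply: sub_sigma_algebra => /=.
rewrite -bigcup_seq/=; exists i => /=; first by rewrite mem_index_enum.
by exists Y => //; rewrite setTI.
Qed.

Lemma measurable_fun_rVP d (T : measurableType d) (R : realType) n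
    (f : T -> 'rV[R]_n) :
  measurable_fun [set: T] f <->
  forall i, measurable_fun [set: T] (rV_coord i \o f).
Proof.
split=> [mf i|mf].
  by apply: measurableT_comp => //; exact: measurable_rV_coord.
have key : g_sigma_preimage (fun i => rV_coord i \o f) `<=` measurable.
  apply: smallest_sub; first exact: sigma_algebra_measurable.
  rewrite -bigcup_seq/=; apply: bigcup_sub => i _ A [B mB <-].
  exact: mf.
move=> _ A mA; apply: key; rewrite g_sigma_preimage_comp.
by exists A.
Qed.

Lemma product_sigma_finite d1 d2 (T1 : measurableType d1)
    (T2 : measurableType d2) (R : realType)
    (m1 : {sigma_finite_measure set T1 -> \bar R})
    (m2 : {sigma_finite_measure set T2 -> \bar R}) :
  sigma_finite setT (m1 \x m2)%E.
Proof.
have /sigma_finiteP[F [TF ndF Foo]] := sigma_finiteT m1.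
have /sigma_finiteP[G [TG ndG Goo]] := sigma_finiteT m2.
exists (fun n => F n `*` G n).
  rewrite -setXTT TF TG predeqE => -[x y]; split.
    move=> [/= [n _ Fnx] [k _ Gky]]; exists (maxn n k) => //; split.
    - by move: x Fnx; exact/subsetPset/ndF/leq_maxl.
    - by move: y Gky; exact/subsetPset/ndG/leq_maxr.
  by move=> [n _ []/= ? ?]; split; exists n.
move=> k; have [? ?] := Foo k; have [? ?] := Goo k.
split; first exact: measurableX.
by rewrite product_measure1E// lte_mul_pinfty// ge0_fin_numE.
Qed.

(* Lebesgue measure on R^n, by iterated product with Lebesgue measure on R;
   R^0 is a point of mass 1. *)
Section lebesgue_rV.
Context {R : realType}.

Definition cons_rV n (z : measurableTypeR R * 'rV[R]_n) : 'rV[R]_n.+1 :=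
  row_mx (z.1)%:M z.2 : 'rV[R]_(1 + n).

Definition uncons_rV n (v : 'rV[R]_n.+1) : measurableTypeR R * 'rV[R]_n :=
  (v ord0 ord0, @rsubmx R 1 1 n v).

Lemma cons_rV0 n z : @cons_rV n z ord0 ord0 = z.1.
Proof.
by rewrite /cons_rV mxE; case: splitP => [j _|//]; rewrite mxE (ord1 j).
Qed.

Lemma cons_rVS n z i : @cons_rV n z ord0 (lift ord0 i) = z.2 ord0 i.
Proof.
rewrite /cons_rV mxE; case: splitP => [j|j [ij]]; first by rewrite ord1.
by congr (z.2 _ _); exact/val_inj.
Qed.

Lemma cons_rVK n : cancel (@cons_rV n) (@uncons_rV n).
Proof.
move=> z; rewrite /uncons_rV cons_rV0 /cons_rV row_mxKr.
by case: z.
Qed.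

Lemma measurable_cons_rV n : measurable_fun [set: _] (@cons_rV n).
Proof.
apply/measurable_fun_rVP => i; case: (unliftP ord0 i) => [j|] ->.
  rewrite (_ : _ \o _ = rV_coord j \o snd).
    apply: measurableT_comp; [exact: measurable_rV_coord|exact: measurable_snd].
  by apply/funext => z; rewrite /rV_coord/= cons_rVS.
rewrite (_ : _ \o _ = fst); first exact: measurable_fst.
by apply/funext => z; rewrite /rV_coord/= cons_rV0.
Qed.

Lemma measurable_uncons_rV n : measurable_fun [set: _] (@uncons_rV n).
Proof.
apply: measurable_fun_pair; first exact: (measurable_rV_coord ord0).
apply/measurable_fun_rVP => i.
rewrite (_ : _ \o _ = rV_coord (rshift 1 i : 'I_n.+1)).
  exact: measurable_rV_coord.
by apply/funext => v; rewrite /rV_coord/= mxE.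
Qed.

Section step.
Context {n : nat}.
Variable mu : {sigma_finite_measure set 'rV[R]_n -> \bar R}.

Definition lebesgue_step : set 'rV[R]_n.+1 -> \bar R :=
  pushforward (lebesgue_measure \x mu)%E (@cons_rV n).

Let lebesgue_step0 : lebesgue_step set0 = 0%E.
Proof. by rewrite /lebesgue_step /pushforward preimage_set0 measure0. Qed.

Let lebesgue_step_ge0 A : (0 <= lebesgue_step A)%E.
Proof. by rewrite /lebesgue_step /pushforward measure_ge0. Qed.

Let lebesgue_step_sigma_additive : semi_sigma_additive lebesgue_step.
Proof.
move=> F mF tF mUF; rewrite /lebesgue_step /pushforward preimage_bigcup.
apply: measure_semi_sigma_additive.
- by move=> k; rewrite -[X in measurable X]setTI; exact: measurable_cons_rV.
- apply/trivIsetP => /= i j _ _ ij; rewrite -preimage_setI.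
  by move/trivIsetP : tF => /(_ _ _ _ _ ij) ->//; rewrite preimage_set0.
- rewrite -preimage_bigcup -[X in measurable X]setTI.
  exact: measurable_cons_rV.
Qed.

HB.instance Definition _ := isMeasure.Build _ _ _ lebesgue_step
  lebesgue_step0 lebesgue_step_ge0 lebesgue_step_sigma_additive.

Lemma lebesgue_step_sigma_finite : sigma_finite setT lebesgue_step.
Proof.
have [F FT mF] := @product_sigma_finite _ _ _ _ R lebesgue_measure mu.
exists (fun k => @uncons_rV n @^-1` F k).
  by rewrite -preimage_bigcup -FT preimage_setT.
move=> k; have [mFk Fk] := mF k; split.
  by rewrite -[X in measurable X]setTI; exact: measurable_uncons_rV.
rewrite /lebesgue_step /pushforward -comp_preimage.
rewrite (_ : _ \o _ = id) ?preimage_id//.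
by apply/funext => z /=; rewrite cons_rVK.
Qed.

HB.instance Definition _ := @Measure_isSigmaFinite.Build _ _ _
  lebesgue_step lebesgue_step_sigma_finite.

End step.

Fixpoint lebesgue_rV (n : nat) : {sigma_finite_measure set 'rV[R]_n -> \bar R} :=
  match n with
  | 0 => \d_ (0 : 'rV[R]_0)
  | m.+1 => lebesgue_step (lebesgue_rV m)
  end.

Lemma lebesgue_rV_box n (A : 'I_n -> set (measurableTypeR R)) :
  (forall i, measurable (A i)) ->
  (lebesgue_rV n [set v | forall i, A i (v ord0 i)] =
   \prod_(i < n) lebesgue_measure (A i))%E.
Proof.
elim: n A => [|n IH] A mA.
  by rewrite big_ord0 /= diracE mem_set//= => -[].
rewrite big_ord_recl -IH// -product_measure1E//; last first.
  rewrite [X in measurable X](_ : _ =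
    \bigcap_(i in [set: 'I_n]) (rV_coord i @^-1` A (lift ord0 i))).
    apply: fin_bigcap_measurable => // i _.
    by rewrite -[X in measurable X]setTI; exact: measurable_rV_coord.
  by apply/seteqP; split => [v h i _|v h i]; exact: h.
rewrite /= /lebesgue_step /pushforward; congr (product_measure1 _ _ _).
apply/seteqP; split => [z /= h|z /= [hx hv] i].
  split => [|i]; first by have := h ord0; rewrite cons_rV0.
  by have := h (lift ord0 i); rewrite cons_rVS.
by case: (unliftP ord0 i) => [j|] ->; rewrite ?cons_rVS ?cons_rV0//; exact: hv.
Qed.

End lebesgue_rV.

Section defs.
Context {R : realType} {n : nat}.

Definition dotv (x t : 'rV[R]_n) : R := \sum_(i < n) x ord0 i * t ord0 i.

Definition polar (T : set 'rV[R]_n) : set 'rV[R]_n :=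
  [set x | forall t, T t -> dotv t x <= 1].

Definition convex_hull (S : set 'rV[R]_n) : set 'rV[R]_n :=
  \bigcap_(C in [set C : set 'rV[R]_n | convex_set C /\ S `<=` C]) C.

Definition absconv (N : nat) (x : 'I_N -> 'rV[R]_n) : set 'rV[R]_n :=
  convex_hull [set v | exists i, v = x i \/ v = - x i].

Context {d : measure_display} {Omega : measurableType d} (P : probability Omega R).

Definition identically_distributed (X Y : Omega -> 'rV[R]_n) :=
  forall A, measurable A -> P (X @^-1` A) = P (Y @^-1` A).

Definition mutually_independent (N : nat) (X : 'I_N -> Omega -> 'rV[R]_n) :=
  forall (J : {set 'I_N}) (A : 'I_N -> set 'rV[R]_n),
    (forall i, measurable (A i)) ->
    P (\bigcap_(i in [set` J]) X i @^-1` A i) =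
    (\prod_(i in J) P (X i @^-1` A i))%E.

Definition symmetric_rvec (X : Omega -> 'rV[R]_n) :=
  identically_distributed X (fun w => - X w).

(* Topological support of the law of X. *)
Definition rvec_support (X : Omega -> 'rV[R]_n) : set 'rV[R]_n :=
  [set x | forall U : set 'rV[R]_n, open U -> U x -> (0 < P (X @^-1` U))%E].

Definition nondegenerate_rvec (X : Omega -> 'rV[R]_n) :=
  forall V : {vspace 'rV[R]_n}, V != fullv -> ~ (rvec_support X `<=` [set` V]).

Definition is_density (X : Omega -> 'rV[R]_n) (f : 'rV[R]_n -> R) :=
  [/\ measurable_fun [set: 'rV[R]_n] (f : _ -> measurableTypeR R),
      (forall x, 0 <= f x) &
      forall A, measurable A ->
        P (X @^-1` A) = (\int[lebesgue_rV n]_(x in A) (f x)%:E)%E].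

Definition log_concave (X : Omega -> 'rV[R]_n) :=
  exists2 f : 'rV[R]_n -> R, is_density X f &
    forall x y, rvec_support X x -> rvec_support X y ->
    forall l : R, 0 < l < 1 ->
      f x `^ l * f y `^ (1 - l) <= f (l *: x + (1 - l) *: y).

(* 'N[P]_p%:E[Z] is (E |Z|^p)^(1/p), as an extended real. *)
Definition Lp_ball (X : Omega -> 'rV[R]_n) (p : R) : set 'rV[R]_n :=
  [set t | ('N[P]_(p%:E)[(fun w => (dotv (X w) t)%:E)] <= 1)%E].

Definition centroid_body (X : Omega -> 'rV[R]_n) (p : R) : set 'rV[R]_n :=
  polar (Lp_ball X p).

End defs.

(* E has probability at least q; no measurability of E is presupposed (inner
   probability), and for measurable E this is q <= P E. *)
Definition with_prob_at_least (R : realType) (d : measure_display)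
    (Omega : measurableType d) (P : probability Omega R) (q : R)
    (E : set Omega) :=
  exists A, [/\ measurable A, A `<=` E & (q%:E <= P A)%E].

(* Main.v *)
Require Import Defs.
From HB Require Import structures.
From mathcomp Require Import all_boot all_order all_algebra.
From mathcomp Require Import all_classical all_reals all_analysis.
From mathcomp Require Import measurable_realfun ring lra.

Set Implicit Arguments.
Unset Strict Implicit.
Unset Printing Implicit Defensive.

Import Order.TTheory GRing.Theory Num.Theory.
Import numFieldTopology.Exports numFieldNormedType.Exports.

Local Open Scope classical_set_scope.
Local Open Scope ring_scope.

(** By duality it suffices that, with the required probability, every t satisfies
    max_i |<X_i, t>| >= c ||<X, t>||_p.

    Prékopa–Leindler and symmetry give the tail inequality G(2a) <= G(a)^2 for
    G(a) = P(|<X, t>| >= a); no other consequence of log-concavity is needed.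
    Summing over dyadic scales, G(a) <= e^{-p/2} forces ||<X, t>||_p <= 96 a, so
    |<X, t>| >= ||<X, t>||_p / 192 with probability at least
    delta = e^{-p/2} = (eN/n)^{-alpha/2}.  Hence, for a fixed t, more than
    delta N / 4 of the X_i are that large outside an event of probability
    e^{-delta N / 4}.  The same inequality yields exponential tails, so that
    sum_i |<X_i, v>| <= 192 N ||<X, v>||_p for all v simultaneously (a 1/2-net
    suffices for this seminorm).  Replacing t by the nearest point of a net of
    mesh of order delta therefore spoils fewer than delta N / 4 indices, and the
    union bound over this net costs n log(C / delta), which is small compared
    with delta N once N / n is large. *)

(** * Prékopa–Leindler inequality *)

(** The threshold exp(-p/2), rather than exp(-p), leaves room: delta N is of order n (N/n)^(1 -
    alpha/2), while the required exponent N^(1-alpha) n^alpha is n (N/n)^(1-alpha). The surplus pays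
    for the net, and 1 - alpha/2 >= 1/2 however close alpha is to 1. That the threshold is a p-th
    power keeps the constant 96 free of p. Two obstacles shape the rest. Log-concavity is assumed
    between points of the topological support, so densities must be cut down to it, once a countable
    base of boxes has shown it to be measurable and of full probability. Independence is a product
    formula for events, so exponential moments become sums over finitely many level configurations,
    and both deviation inequalities are instances of one Markov bound. Nets are taken for the L_p
    norm itself, so that comparing volumes bounds their size by the dimension and the mesh alone;
    non-degeneracy makes it a norm, with balls of finite volume. The exceptional events are built as
    finite unions of measurable sets, which yields the measurable event required inside the
    inclusion event. *)

Section affine_line.
Context {R : realType}.
Local Notation mu := (@lebesgue_measure R).

Lemma measurable_affine (c b : R) :
  measurable_fun [set: measurableTypeR R]
    (fun x : measurableTypeR R => c * x + b : measurableTypeR R).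
Proof.
by apply: measurable_funD => //; apply: measurable_funM.
Qed.

(** Uniqueness of Lebesgue measure: [c] times the image measure gives every half-open interval its
    length. *)
Lemma lebesgue_measure_affine (c b : R) (A : set (measurableTypeR R)) :
  0 < c -> measurable A ->
  mu ((fun x : measurableTypeR R => c * x + b) @^-1` A) = (c^-1%:E * mu A)%E.
Proof.
move=> c0 mA.
pose phi (x : measurableTypeR R) : measurableTypeR R := c * x + b.
pose nu0 mf : {measure set (measurableTypeR R) -> \bar R} :=
  (@measure_function_pushforward__canonical__measure_function_Measure
    _ _ _ _ _ mu phi mf).
have c0' : 0 <= c by exact: ltW.
pose nu : {measure set (measurableTypeR R) -> \bar R} :=
  mscale (NngNum c0') (nu0 (measurable_affine c b)).
have nuE : forall A, measurable A -> mu A = nu A.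
  apply: lebesgue_measure_unique => _ [[x y]] _ <-.
  change (mu `]x, y] = (c%:E * mu (phi @^-1` `]x, y]))%E).
  rewrite (_ : _ @^-1` _ = `](x - b) / c, (y - b) / c]%classic); last first.
    apply/seteqP; split => z /=; rewrite !in_itv/= ltr_pdivrMr// ler_pdivlMr// /phi.
      by move=> /andP[? ?]; apply/andP; split; nra.
    by move=> /andP[? ?]; apply/andP; split; nra.
  rewrite !lebesgue_measure_itv/= !lte_fin.
  rewrite ltr_pM2r ?invr_gt0// ltrD2r.
  case: ifPn => _; last by rewrite mule0.
  by rewrite -!EFinB -EFinM; congr EFin; field; rewrite gt_eqF.
rewrite [in RHS]nuE//.
change (mu (phi @^-1` A) = (c^-1%:E * (c%:E * mu (phi @^-1` A)))%E).
rewrite muleA -EFinM mulVf ?gt_eqF//.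
by rewrite mul1e.
Qed.

Lemma ge0_integral_affine (c b : R) (f : measurableTypeR R -> \bar R) :
  0 < c -> measurable_fun [set: _] f -> (forall x, 0 <= f x)%E ->
  (\int[mu]_x f (c * x + b)%R = c^-1%:E * \int[mu]_x f x)%E.
Proof.
move=> c0 mf f0.
have c0' : 0 <= c^-1 by rewrite invr_ge0 ltW.
have := @ge0_integral_pushforward _ _ _ _ R _ (measurable_affine c b) mu setT f
  measurableT mf (fun y _ => f0 y).
rewrite preimage_setT => <-.
rewrite -[X in (X * _)%E]/((NngNum c0')%:num%:E) -ge0_integral_mscale//.
pose phi (x : measurableTypeR R) : measurableTypeR R := c * x + b.
pose nu0 mf : {measure set (measurableTypeR R) -> \bar R} :=
  (@measure_function_pushforward__canonical__measure_function_Measure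
    _ _ _ _ _ mu phi mf).
apply: (@eq_measure_integral _ _ R setT _ (nu0 (measurable_affine c b)) f) => A mA _.
by rewrite /= /mscale/= -(lebesgue_measure_affine b)// -[c^-1^-1]invrK.
Qed.

End affine_line.

Section brunn_minkowski_line.
Context {R : realType}.
Local Notation mu := (@lebesgue_measure R).

(* Slide A to the left of B: up to one point and an error e, the translates
   (A + b) / 2 and (a + B) / 2 are disjoint when a is nearly sup A and b is
   nearly inf B. *)
Lemma brunn_minkowski_line (k : R) (A B C : set (measurableTypeR R)) :
  measurable A -> measurable B -> measurable C ->
  A !=set0 -> B !=set0 -> A `<=` `[- k, k] -> B `<=` `[- k, k] ->
  (forall x y, A x -> B y -> C (2^-1 * (x + y))) ->
  (mu A + mu B <= 2%:E * mu C)%E.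
Proof.
move=> mA mB mC A0 B0 Ak Bk ABC.
have supA : has_sup A.
  by split => //; exists k => x /Ak /=; rewrite in_itv/= => /andP[].
have infB : has_inf B.
  by split => //; exists (- k) => x /Bk /=; rewrite in_itv/= => /andP[].
apply/lee_addgt0Pr => e e0.
have e20 : 0 < e / 2 by rewrite divr_gt0.
have [a Aa ea] := sup_adherent e20 supA.
have [b Bb eb] := inf_adherent e20 infB.
pose A' := A `&` `]-oo, a]; pose B' := B `&` `]b, +oo[.
have mA' : measurable A' by exact: measurableI.
have mB' : measurable B' by exact: measurableI.
have AA' : (mu A <= mu A' + (e/2)%:E)%E.
  have -> : (e/2)%:E = mu `]a, a + e/2].
    by rewrite lebesgue_measure_itv/= lte_fin ltrDl e20 -EFinB; congr EFin; ring.
  apply: le_trans (measureU2 _ _ _) => //.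
  apply: le_measure; rewrite ?inE//; first exact: measurableU.
  move=> x Ax; have [xa|ax] := leP x a; [left; split => //=; rewrite in_itv//|right].
  rewrite /= in_itv/= ax /=.
  by have := sup_upper_bound supA Ax; lra.
have BB' : (mu B <= mu B' + (e/2)%:E)%E.
  have -> : (e/2)%:E = mu `[b - e/2, b].
    by rewrite lebesgue_measure_itv/= lte_fin gtrBl e20 -EFinB; congr EFin; ring.
  apply: le_trans (measureU2 _ _ _) => //.
  apply: le_measure; rewrite ?inE//; first exact: measurableU.
  move=> x Ax; have [xa|ax] := leP x b;
    [right|left; split => //=; rewrite in_itv/= andbT//].
  rewrite /= in_itv/= xa andbT.
  by have := ge_inf infB.2 Ax; lra.
pose A2 := (fun x : measurableTypeR R => 2 * x + (- b)) @^-1` A'.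
pose B2 := (fun x : measurableTypeR R => 2 * x + (- a)) @^-1` B'.
have mA2 : measurable A2 by rewrite -[A2]setTI; apply: measurable_affine.
have mB2 : measurable B2 by rewrite -[B2]setTI; apply: measurable_affine.
have ABle : (mu A2 + mu B2 <= mu C)%E.
  rewrite -measureU//.
    apply: le_measure; rewrite ?inE//; first exact: measurableU.
    move=> z [[Az _]|[Bz _]].
      by have := ABC _ _ Az Bb; congr C; field.
    by have := ABC _ _ Aa Bz; congr C; field.
  apply/seteqP; split => // z [[_ /=]] + [_ /=]; rewrite !in_itv/= andbT.
  by move=> ? ?; lra.
move: ABle; rewrite /A2 /B2 !lebesgue_measure_affine// => ABle.
have {ABle} : (2%:E * (2^-1%:E * mu A' + 2^-1%:E * mu B') <= 2%:E * mu C)%E.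
  by rewrite lee_pmul2l.
rewrite -ge0_muleDr// muleA -EFinM mulfV// mul1e => ABle.
apply: (@le_trans _ _ ((mu A' + (e/2)%:E) + (mu B' + (e/2)%:E)))%E.
  exact: leeD.
rewrite addeACA -EFinD -splitr.
by apply: leeD.
Qed.

End brunn_minkowski_line.

(** * Layer-cake formula and Prékopa-Leindler on the line *)

Lemma measurable_ltr d (T : measurableType d) (R : realType) (f g : T -> R) :
  measurable_fun [set: T] f -> measurable_fun [set: T] g ->
  measurable [set x | f x < g x].
Proof.
move=> mf mg; have := measurable_fun_ltr mf mg.
by move=> /(_ measurableT [set true]); rewrite setTI; exact.
Qed.

Lemma measurable_subgraph d (T : measurableType d) (R : realType) (f : T -> R) :
  measurable_fun [set: T] f ->
  measurable [set z : T * measurableTypeR R | 0 < z.2 < f z.1].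
Proof.
move=> mf; rewrite (_ : [set _ | _] =
  [set z : T * measurableTypeR R | 0 < z.2] `&` [set z | z.2 < f z.1]).
  apply: measurableI; apply: measurable_ltr => //; try exact: measurable_snd.
  by apply: measurableT_comp => //; exact: measurable_fst.
by apply/seteqP; split => z /= => [/andP[]|[-> ->]].
Qed.

(** Tonelli for the region under the graph of [f]. The condition [0 < t] sits inside the set so that
    the outer integral can run over the whole line. *)
Lemma ge0_layer_cake d (T : measurableType d) (R : realType)
    (m : {sigma_finite_measure set T -> \bar R}) (f : T -> R) :
  measurable_fun [set: T] f -> (forall x, 0 <= f x) ->
  (\int[m]_x (f x)%:E =
   \int[lebesgue_measure]_t m [set x | 0 < t < f x]%R)%E.
Proof.
move=> mf f0.
pose A := [set z : T * measurableTypeR R | 0 < z.2 < f z.1].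
have mA : measurable A by exact: measurable_subgraph.
have := indic_fubini_tonelli m (@lebesgue_measure R) mA.
rewrite indic_fubini_tonelli_FE// indic_fubini_tonelli_GE//= => E.
transitivity (\int[m]_x lebesgue_measure (xsection A x))%E.
  apply: eq_integral => x _; rewrite (_ : xsection A x = `]0, f x[%classic).
    rewrite lebesgue_measure_itv/= lte_fin.
    by case: ltgtP (f0 x) => // [_ _|<- _//]; rewrite sube0.
  by apply/seteqP; split => t; rewrite /xsection/= inE/= in_itv.
rewrite E; apply: eq_integral => t _; congr (m _).
by apply/seteqP; split => x; rewrite /ysection/= inE.
Qed.

Section prekopa_leindler_line.
Context {R : realType}.
Local Notation mu := (@lebesgue_measure R).
Local Notation T := (measurableTypeR R).

Lemma measurable_fun_gtr d (S : measurableType d) (f : S -> R) (t : R) :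
  measurable_fun [set: S] f -> measurable [set x | 0 < t < f x].
Proof.
move=> mf; have [t0|t0] := ltP 0 t.
  rewrite (_ : [set _ | _] = f @^-1` `]t, +oo[%classic).
    by rewrite -[X in measurable X]setTI; exact: mf.
  by apply/seteqP; split => x /=; rewrite in_itv/= andbT.
by rewrite (_ : [set _ | _] = set0)//; apply/seteqP; split.
Qed.

(** The one-dimensional Brunn-Minkowski inequality for the superlevel sets at height [t], integrated
    over [t]. Both suprema are normalised to 1 so that the level sets of [f] and [g] are nonempty
    for the same [t]. *)
Lemma additive_prekopa_leindler_line (k : R) (f g h : T -> R) :
  measurable_fun [set: T] f -> measurable_fun [set: T] g ->
  measurable_fun [set: T] h ->
  (forall x, 0 <= f x <= 1) -> (forall x, 0 <= g x <= 1) ->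
  (forall x, 0 <= h x) ->
  (forall x, 0 < f x -> - k <= x <= k) ->
  (forall x, 0 < g x -> - k <= x <= k) ->
  (forall t, t < 1 -> exists x, t < f x) ->
  (forall t, t < 1 -> exists x, t < g x) ->
  (forall t x y, 0 < t -> t < f x -> t < g y -> t < h (2^-1 * (x + y))) ->
  (\int[mu]_x (f x)%:E + \int[mu]_x (g x)%:E <= 2%:E * \int[mu]_x (h x)%:E)%E.
Proof.
move=> mf mg mh f01 g01 h0 fk gk f1 g1 fgh.
have f0 x : 0 <= f x by case/andP: (f01 x).
have g0 x : 0 <= g x by case/andP: (g01 x).
rewrite !ge0_layer_cake//.
have mphi (u : T -> R) : measurable_fun [set: T] u ->
    measurable_fun [set: T] (fun t : T => mu [set x | 0 < t < u x]).
  move=> mu'.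
  pose A := [set z : T * T | 0 < z.2 < u z.1].
  have mA : measurable A by exact: measurable_subgraph.
  have := measurable_fun_ysection mu mA; congr measurable_fun.
  apply/funext => t /=; congr (mu _).
  by apply/seteqP; split => x; rewrite /ysection/= inE.
rewrite -ge0_integralD//; [|exact: mphi..].
rewrite -ge0_integralZl//; [|exact: mphi].
apply: ge0_le_integral => //.
- by move=> t _; rewrite adde_ge0.
- by apply: emeasurable_funD; exact: mphi.
- by apply: measurable_funeM; exact: mphi.
move=> t _; have [t0|t0] := pselect (0 < t); last first.
  have E (u : T -> R) : [set x | 0 < t < u x] = set0.
    by apply/seteqP; split => x //= /andP[].
  by rewrite !E !measure0 adde0 mule0.
have [t1|t1] := ltP t 1; last first.
  rewrite [X in (mu X + _)%E](_ : _ = set0); last first.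
    by apply/seteqP; split => x //= tx; have := f01 x; lra.
  rewrite [X in (_ + mu X)%E](_ : _ = set0); last first.
    by apply/seteqP; split => x //= tx; have := g01 x; lra.
  by rewrite measure0 adde0 mule_ge0.
apply: (@brunn_minkowski_line R k).
- exact: measurable_fun_gtr.
- exact: measurable_fun_gtr.
- exact: measurable_fun_gtr.
- by have [x tx] := f1 _ t1; exists x; rewrite /= t0.
- by have [x tx] := g1 _ t1; exists x; rewrite /= t0.
- by move=> x /= /andP[_ tx]; rewrite in_itv/=; apply: fk; lra.
- by move=> x /= /andP[_ tx]; rewrite in_itv/=; apply: gk; lra.
- by move=> x y /= /andP[_ tx] /andP[_ ty]; rewrite t0; exact: fgh.
Qed.

End prekopa_leindler_line.

Section prekopa_leindler.
Context {R : realType}.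
Local Notation mu := (@lebesgue_measure R).
Local Notation T := (measurableTypeR R).
Local Open Scope ereal_scope.

(** Dividing [f], [g], [h] by [F], [G] and [s = sqrt (F G)], where [F] and [G] are the suprema,
    reduces this to the additive form; the product form then follows from the arithmetic-geometric
    mean inequality. *)
Lemma bounded_prekopa_leindler_line (k M : R) (f g : T -> R) (h : T -> \bar R) :
  measurable_fun [set: T] f -> measurable_fun [set: T] g ->
  measurable_fun [set: T] h ->
  (forall x, 0 <= f x <= M)%R -> (forall x, 0 <= g x <= M)%R ->
  (forall x, 0 <= h x) ->
  (forall x, 0 < f x -> - k <= x <= k)%R ->
  (forall x, 0 < g x -> - k <= x <= k)%R ->
  (forall x y, (f x * g y)%:E <= h (2^-1 * (x + y))%R * h (2^-1 * (x + y))%R) ->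
  \int[mu]_x (f x)%:E * \int[mu]_x (g x)%:E <= \int[mu]_x h x * \int[mu]_x h x.
Proof.
move=> mf mg mh f0M g0M h0 fk gk fgh.
have key (u : T -> R) : measurable_fun [set: T] u ->
    (forall x, 0 <= u x <= M)%R -> (forall x, 0 < u x -> - k <= x <= k)%R ->
    (exists2 a : R, (0 <= a)%R & \int[mu]_x (u x)%:E = a%:E) /\
    exists U : R, [/\ (0 <= U)%R, forall x, (u x <= U)%R &
      forall t : R, (t < U)%R -> exists x, (t < u x)%R].
  move=> mu' u0M uk; split.
    have Ifin : \int[mu]_x (u x)%:E < +oo.
      apply: (@le_lt_trans _ _ (\int[mu]_x (M * \1_(`[- k, k]) x)%R%:E)).
        apply: ge0_le_integral => //.
        - by move=> x _; rewrite lee_fin; case/andP: (u0M x).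
        - exact/measurable_EFinP.
        - apply/measurable_EFinP; apply: measurable_funM => //.
        - move=> x _; rewrite lee_fin indicE; have [xk|xk] := boolP (x \in _).
            by rewrite mulr1; case/andP: (u0M x).
          rewrite mulr0 leNgt; apply/negP => /uk kx.
          by move: xk; rewrite notin_setE/=; apply; rewrite in_itv.
      have M0 : (0 <= M)%R by have := u0M 0%R; lra.
      under eq_integral do rewrite EFinM.
      rewrite ge0_integralZl//; last exact/measurable_EFinP.
      rewrite integral_indic// setIT lte_mul_pinfty//.
      by rewrite /= lebesgue_measure_itv/=; case: ifP => _; rewrite ?ltry// -EFinB ltry.
    have I0 : 0 <= \int[mu]_x (u x)%:E.
      by apply: integral_ge0 => x _; rewrite lee_fin; case/andP: (u0M x).
    exists (fine (\int[mu]_x (u x)%:E)); first exact: fine_ge0.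
    by rewrite fineK// ge0_fin_numE.
  have su : has_sup (range u).
    by split; [exists (u 0%R); exists 0%R|exists M => _ [x _ <-]; case/andP: (u0M x)].
  have uU x : (u x <= sup (range u))%R.
    by apply: sup_upper_bound => //; exists x.
  exists (sup (range u)); split => //.
    by apply: le_trans (uU 0%R); case/andP: (u0M 0%R).
  by move=> t /(sup_gt su.1)[_ [x _ <-]] tx; exists x.
have [[a a0 fa] [F [F0 fF fF']]] := key f mf f0M fk.
have [[b b0 gb] [G [G0 gG gG']]] := key g mg g0M gk.
have Ih0 : 0 <= \int[mu]_x h x by apply: integral_ge0 => x _.
move: F0; rewrite le_eqVlt => /predU1P[F0|F0].
  rewrite [X in X * _](_ : _ = 0) ?mul0e ?mule_ge0//.
  apply: integral0_eq => x _; congr EFin; apply/eqP; rewrite eq_le.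
  by have /andP[-> _] := f0M x; rewrite F0 fF.
move: G0; rewrite le_eqVlt => /predU1P[G0|G0].
  rewrite [X in _ * X](_ : _ = 0) ?mule0 ?mule_ge0//.
  apply: integral0_eq => x _; congr EFin; apply/eqP; rewrite eq_le.
  by have /andP[-> _] := g0M x; rewrite G0 gG.
pose s := Num.sqrt (F * G).
have s0 : (0 < s)%R by rewrite sqrtr_gt0 mulr_gt0.
have s2 : (s ^+ 2 = F * G)%R by rewrite sqr_sqrtr// mulr_ge0// ltW.
(* Capping [h] at [s] makes it real-valued and costs nothing: the additive form compares only levels
   below 1, that is, values of [h] below [s]. *)
pose h' x := (s^-1 * fine (mine (h x) s%:E))%R.
have mh0 x : 0 <= mine (h x) s%:E by rewrite le_min h0 lee_fin ltW.
have mhs x : mine (h x) s%:E <= s%:E by rewrite ge_min lexx orbT.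
have mhfin x : mine (h x) s%:E \is a fin_num.
  by rewrite ge0_fin_numE// (le_lt_trans (mhs x)) ?ltry.
have mh' : measurable_fun [set: T] h'.
  apply: measurable_funM => //.
  apply: (measurableT_comp (fine_measurable measurableT)).
  exact: measurable_mine.
have norm01 (u : T -> R) (U : R) : (0 < U)%R -> (forall x, 0 <= u x <= M)%R ->
    (forall x, u x <= U)%R -> forall x, (0 <= U^-1 * u x <= 1)%R.
  move=> U0 u0 uU x; have /andP[ux _] := u0 x.
  by rewrite mulr_ge0 ?invr_ge0 ?(ltW U0)//= mulrC ler_pdivrMr// mul1r.
have pos (u : T -> R) (U : R) : (0 < U)%R -> forall x,
    (0 < U^-1 * u x)%R -> (0 < u x)%R.
  by move=> U0 x; rewrite pmulr_rgt0// invr_gt0.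
have := @additive_prekopa_leindler_line R k (fun x => F^-1 * f x)%R
  (fun x => G^-1 * g x)%R h'.
have -> : \int[mu]_x (F^-1 * f x)%:E = (F^-1 * a)%:E.
  under eq_integral do rewrite EFinM.
  rewrite ge0_integralZl//; [by rewrite fa -EFinM| exact/measurable_EFinP | |].
    by move=> x _; rewrite lee_fin; case/andP: (f0M x).
  by rewrite lee_fin invr_ge0 ltW.
have -> : \int[mu]_x (G^-1 * g x)%:E = (G^-1 * b)%:E.
  under eq_integral do rewrite EFinM.
  rewrite ge0_integralZl//; [by rewrite gb -EFinM| exact/measurable_EFinP | |].
    by move=> x _; rewrite lee_fin; case/andP: (g0M x).
  by rewrite lee_fin invr_ge0 ltW.
move=> /(_ (measurable_funM (measurable_cst _) mf)
  (measurable_funM (measurable_cst _) mg) mh' (norm01 _ _ F0 f0M fF)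
  (norm01 _ _ G0 g0M gG)).
have h'0 x : (0 <= h' x)%R.
  by rewrite mulr_ge0 ?invr_ge0 ?(ltW s0)// fine_ge0.
move=> /(_ h'0 (fun x Hx => fk x (pos _ _ F0 x Hx))
  (fun x Hx => gk x (pos _ _ G0 x Hx))) PL.
have {}PL : (F^-1 * a + G^-1 * b)%:E <= 2%:E * \int[mu]_x (h' x)%:E.
  rewrite EFinD; apply: PL.
  - move=> t t1; have [|x] := fF' (t * F)%R; first by rewrite gtr_pMl.
    by rewrite -ltr_pdivlMr// mulrC; exists x.
  - move=> t t1; have [|x] := gG' (t * G)%R; first by rewrite gtr_pMl.
    by rewrite -ltr_pdivlMr// mulrC; exists x.
  - move=> t x y t0 tx ty; rewrite /h' mulrC ltr_pdivlMr//.
    rewrite -lte_fin fineK// lt_min; apply/andP; split; last first.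
      rewrite lte_fin gtr_pMl//; apply: lt_le_trans tx _.
      by have /andP[] := norm01 _ _ F0 f0M fF x.
    have := fgh x y; have := h0 (2^-1 * (x + y))%R.
    case: (h _) => [r| |]//; rewrite ?ltry//= !lee_fin lte_fin -expr2 => r0 fgr.
    have tF : (t * F < f x)%R by rewrite -ltr_pdivlMr// mulrC.
    have tG : (t * G < g y)%R by rewrite -ltr_pdivlMr// mulrC.
    have : ((t * s) ^+ 2 < r ^+ 2)%R.
      apply: lt_le_trans fgr; rewrite exprMn s2.
      apply: (@lt_trans _ _ ((t * F) * g y)%R); last first.
        by rewrite ltr_pM2r// (lt_trans _ tG)// mulr_gt0.
      by rewrite expr2 mulrACA ltr_pM2l// mulr_gt0.
    by rewrite ltr_pXn2r// nnegrE mulr_ge0// ltW.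
have Ih'h : \int[mu]_x (h' x)%:E <= s^-1%:E * \int[mu]_x h x.
  rewrite -ge0_integralZl//; last by rewrite lee_fin invr_ge0 ltW.
  apply: ge0_le_integral => //.
  - by move=> x _; rewrite lee_fin mulr_ge0 ?invr_ge0 ?(ltW s0)// fine_ge0.
  - exact/measurable_EFinP.
  - exact: measurable_funeM.
  - move=> x _; rewrite EFinM fineK// lee_pmul2l//; last by rewrite lte_fin invr_gt0.
    by rewrite ge_min lexx.
have {PL Ih'h} : (F^-1 * a + G^-1 * b)%:E <= 2%:E * (s^-1%:E * \int[mu]_x h x).
  by apply: le_trans PL _; rewrite lee_pmul2l.
rewrite fa gb; case: (\int[mu]_x h x) Ih0 => [c| |]//; last first.
  by move=> _ _; rewrite mulyy leey.
rewrite -!EFinM !lee_fin => c0.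
(* With [D = c / s], the bound [A + B <= 2 D] gives [A B <= D^2], because [4 A B <= (A + B)^2]. *)
set A := (F^-1 * a)%R; set B := (G^-1 * b)%R => AB.
have -> : a = (F * A)%R by rewrite mulrA mulfV ?mul1r// gt_eqF.
have -> : b = (G * B)%R by rewrite mulrA mulfV ?mul1r// gt_eqF.
rewrite mulrACA -s2.
have A0 : (0 <= A)%R by rewrite mulr_ge0// invr_ge0 ltW.
have B0 : (0 <= B)%R by rewrite mulr_ge0// invr_ge0 ltW.
set D := (s^-1 * c)%R in AB.
have -> : c = (s * D)%R by rewrite mulrA mulfV ?mul1r// gt_eqF.
rewrite [leRHS]mulrACA -expr2 ler_pM2l ?exprn_gt0//.
by have := sqr_ge0 (A - B)%R; nra.
Qed.

(** Bounded functions of bounded support increasing to [f]: monotone convergence carries the bounded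
    case over to extended-valued functions. *)
Definition truncate (f : T -> \bar R) (k : nat) (x : T) : R :=
  (\1_(`[- k%:R, k%:R]) x * fine (mine (f x) k%:R%:E))%R.

Lemma truncate_bound f k x : 0 <= f x -> (0 <= truncate f k x <= k%:R)%R.
Proof.
move=> f0; have m0 : 0 <= mine (f x) k%:R%:E by rewrite le_min f0 lee_fin ler0n.
have mk : mine (f x) k%:R%:E <= k%:R%:E by rewrite ge_min lexx orbT.
have mfin : mine (f x) k%:R%:E \is a fin_num.
  by rewrite ge0_fin_numE// (le_lt_trans mk) ?ltry.
rewrite /truncate indicE; case: (_ \in _); rewrite ?mul0r ?mul1r ?lexx ?ler0n//.
by rewrite fine_ge0//= -lee_fin fineK.
Qed.

Lemma truncate_le f k x : 0 <= f x -> (truncate f k x)%:E <= f x.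
Proof.
move=> f0; have m0 : 0 <= mine (f x) k%:R%:E by rewrite le_min f0 lee_fin ler0n.
have mk : mine (f x) k%:R%:E <= k%:R%:E by rewrite ge_min lexx orbT.
have mfin : mine (f x) k%:R%:E \is a fin_num.
  by rewrite ge0_fin_numE// (le_lt_trans mk) ?ltry.
rewrite /truncate indicE; case: (_ \in _); rewrite ?mul0r ?mul1r//.
by rewrite fineK// ge_min lexx.
Qed.

Lemma truncateE f k x : 0 <= f x -> (`|x| <= k%:R)%R ->
  (truncate f k x)%:E = mine (f x) k%:R%:E.
Proof.
move=> f0; rewrite ler_norml => xk.
have m0 : 0 <= mine (f x) k%:R%:E by rewrite le_min f0 lee_fin ler0n.
have mk : mine (f x) k%:R%:E <= k%:R%:E by rewrite ge_min lexx orbT.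
have mfin : mine (f x) k%:R%:E \is a fin_num.
  by rewrite ge0_fin_numE// (le_lt_trans mk) ?ltry.
by rewrite /truncate indicE mem_set ?mul1r ?fineK//= in_itv.
Qed.

Lemma truncate_nd f x : 0 <= f x ->
  nondecreasing_seq (fun k => (truncate f k x)%:E).
Proof.
move=> f0 k l kl; have [xk|xk] := leP `|x|%R k%:R.
  rewrite !truncateE//; last by rewrite (le_trans xk)// ler_nat.
  by rewrite le_min !ge_min lexx/= lee_fin ler_nat kl orbT.
rewrite {1}/truncate indicE memNset ?mul0r.
  by rewrite lee_fin; case/andP: (truncate_bound l f0).
by rewrite /= in_itv/= -ler_norml leNgt xk.
Qed.

Lemma measurable_truncate f k : measurable_fun [set: T] f ->
  measurable_fun [set: T] (truncate f k).
Proof.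
move=> mf; apply: measurable_funM => //.
apply: (measurableT_comp (fine_measurable measurableT)).
exact: measurable_mine.
Qed.

Lemma cvg_truncate f x : 0 <= f x ->
  (truncate f k x)%:E @[k --> \oo] --> f x.
Proof.
move=> f0; have [n0 xn0] : exists n0 : nat, (`|x| <= n0%:R)%R.
  by exists (Num.truncn `|x|).+1; exact/ltW/truncnS_gt.
case E: (f x) f0 => [r| |]// f0.
  apply: cvg_near_cst; exists (maxn n0 (Num.truncn `|r|).+1) => // k /=.
  rewrite geq_max => /andP[n0k rk].
  rewrite truncateE ?E//; last by rewrite (le_trans xn0)// ler_nat.
  apply/min_idPl; rewrite lee_fin (le_trans (ler_norm _))//.
  by rewrite (le_trans (ltW (truncnS_gt _)))// ler_nat.
have : (k%:R : R)%:E @[k --> \oo] --> +oo by apply/cvgenyP.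
apply: cvg_trans; apply: near_eq_cvg; exists n0 => // k /= n0k.
by rewrite truncateE ?E//; last by rewrite (le_trans xn0)// ler_nat.
Qed.

Lemma cvg_integral_truncate f : measurable_fun [set: T] f ->
  (forall x, 0 <= f x) ->
  \int[mu]_x (truncate f k x)%:E @[k --> \oo] --> \int[mu]_x f x.
Proof.
move=> mf f0.
have -> : \int[mu]_x f x = \int[mu]_x limn (fun k => (truncate f k x)%:E).
  by apply: eq_integral => x _; apply/esym/cvg_lim => //; exact: cvg_truncate.
apply: (@cvg_monotone_convergence _ _ R mu setT measurableT
  (fun k x => (truncate f k x)%:E)).
- by move=> k; apply/measurable_EFinP; exact: measurable_truncate.
- by move=> k x _; rewrite lee_fin; case/andP: (truncate_bound k (f0 x)).
- by move=> x _; exact: truncate_nd.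
Qed.

Lemma prekopa_leindler_line (f g h : T -> \bar R) :
  measurable_fun [set: T] f -> measurable_fun [set: T] g ->
  measurable_fun [set: T] h ->
  (forall x, 0 <= f x) -> (forall x, 0 <= g x) -> (forall x, 0 <= h x) ->
  (forall x y, f x * g y <= h (2^-1 * (x + y))%R * h (2^-1 * (x + y))%R) ->
  \int[mu]_x f x * \int[mu]_x g x <= \int[mu]_x h x * \int[mu]_x h x.
Proof.
move=> mf mg mh f0 g0 h0 fgh.
have If0 : 0 <= \int[mu]_x f x by exact: integral_ge0.
have Ig0 : 0 <= \int[mu]_x g x by exact: integral_ge0.
have Ih0 : 0 <= \int[mu]_x h x by exact: integral_ge0.
(* Zero integrals are set aside because the limit of a product in the extended reals excludes the
   form zero times infinity. *)
have [->|If1] := eqVneq (\int[mu]_x f x) 0; first by rewrite mul0e mule_ge0.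
have [->|Ig1] := eqVneq (\int[mu]_x g x) 0; first by rewrite mule0 mule_ge0.
have tpos (u : T -> \bar R) k x : 0 <= u x ->
    (0 < truncate u k x -> - k%:R <= x <= k%:R)%R.
  move=> u0; rewrite /truncate indicE; have [xk|] := boolP (_ \in _).
    by move: xk; rewrite inE/= in_itv.
  by rewrite mul0r ltxx.
have kk k : \int[mu]_x (truncate f k x)%:E * \int[mu]_x (truncate g k x)%:E <=
    \int[mu]_x h x * \int[mu]_x h x.
  apply: (@bounded_prekopa_leindler_line k%:R k%:R) => //.
  - exact: measurable_truncate.
  - exact: measurable_truncate.
  - by move=> x; exact: truncate_bound.
  - by move=> x; exact: truncate_bound.
  - by move=> x; exact: tpos.
  - by move=> x; exact: tpos.
  - move=> x y; apply: le_trans (fgh x y); rewrite EFinM lee_pmul//.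
    + by rewrite lee_fin; case/andP: (truncate_bound k (f0 x)).
    + by rewrite lee_fin; case/andP: (truncate_bound k (g0 y)).
    + exact: truncate_le.
    + exact: truncate_le.
have cvgfg : \int[mu]_x (truncate f k x)%:E * \int[mu]_x (truncate g k x)%:E
    @[k --> \oo] --> \int[mu]_x f x * \int[mu]_x g x.
  apply: cvgeM; [|exact: cvg_integral_truncate..].
  by apply: neq0_mule_def; rewrite mule_eq0 negb_or If1 Ig1.
rewrite -(cvg_lim _ cvgfg)//; apply: lime_le; last exact: nearW.
by apply/cvg_ex; eexists; exact: cvgfg.
Qed.

End prekopa_leindler.

(** * Integration over R^n and Prékopa-Leindler in every dimension *)

Section lebesgue_rV_integral.
Context {R : realType}.
Local Notation mu := (@lebesgue_measure R).
Local Notation T := (measurableTypeR R).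
Local Open Scope ereal_scope.

Lemma measurable_fun_cons_rV n (f : 'rV[R]_n.+1 -> \bar R) :
  measurable_fun [set: _] f ->
  measurable_fun [set: T * 'rV[R]_n] (f \o @cons_rV R n).
Proof. by move=> mf; apply: measurableT_comp mf _; exact: measurable_cons_rV. Qed.

Lemma integral_lebesgue_rVS n (f : 'rV[R]_n.+1 -> \bar R) :
  measurable_fun [set: _] f -> (forall x, 0 <= f x) ->
  \int[lebesgue_rV n.+1]_x f x =
  \int[mu]_x \int[lebesgue_rV n]_y f (cons_rV (x, y)).
Proof.
move=> mf f0.
have := @ge0_integral_pushforward _ _ _ _ R _ (@measurable_cons_rV R n)
  (mu \x lebesgue_rV n) setT f measurableT mf (fun y _ => f0 y).
rewrite preimage_setT => E.
transitivity (\int[mu \x lebesgue_rV n]_z (f \o @cons_rV R n) z).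
  rewrite -E; apply: eq_measure_integral; first exact: measurable_cons_rV.
  by [].
rewrite fubini_tonelli1//; last by move=> x; exact: f0.
exact: measurable_fun_cons_rV.
Qed.

Lemma measurable_fun_marginal n (f : 'rV[R]_n.+1 -> \bar R) :
  measurable_fun [set: _] f -> (forall x, 0 <= f x) ->
  measurable_fun [set: T]
    (fun x : T => \int[lebesgue_rV n]_y f (cons_rV (x, y))).
Proof.
move=> mf f0.
apply: (@measurable_fun_fubini_tonelli_F _ _ _ _ R _ (f \o @cons_rV R n)).
- exact: measurable_fun_cons_rV.
- by move=> x; exact: f0.
Qed.

Lemma measurable_fun_section n (f : 'rV[R]_n.+1 -> \bar R) (x : T) :
  measurable_fun [set: _] f ->
  measurable_fun [set: 'rV[R]_n] (fun y => f (cons_rV (x, y))).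
Proof.
move=> mf; apply: (measurableT_comp mf).
by apply: measurableT_comp (@measurable_cons_rV R n) _.
Qed.

(** Induction on the dimension: the inductive statement for sections at [x] and [y] is exactly the
    one-dimensional hypothesis for the marginals. These may be infinite, hence the extended-valued
    functions; writing the hypothesis with a product and a square avoids powers of extended
    reals. *)
Lemma prekopa_leindler n (f g h : 'rV[R]_n -> \bar R) :
  measurable_fun [set: _] f -> measurable_fun [set: _] g ->
  measurable_fun [set: _] h ->
  (forall x, 0 <= f x) -> (forall x, 0 <= g x) -> (forall x, 0 <= h x) ->
  (forall x y, f x * g y <= h (2^-1 *: (x + y))%R * h (2^-1 *: (x + y))%R) ->
  \int[lebesgue_rV n]_x f x * \int[lebesgue_rV n]_x g x <=
  \int[lebesgue_rV n]_x h x * \int[lebesgue_rV n]_x h x.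
Proof.
elim: n f g h => [|n IH] f g h mf mg mh f0 g0 h0 fgh.
  rewrite /= !integral_dirac// diracT !mul1e.
  by have := fgh 0%R 0%R; rewrite addr0 scaler0.
rewrite !integral_lebesgue_rVS//.
apply: prekopa_leindler_line; try exact: measurable_fun_marginal.
- by move=> x; exact: integral_ge0.
- by move=> x; exact: integral_ge0.
- by move=> x; exact: integral_ge0.
move=> x y; apply: IH => //; try exact: measurable_fun_section.
move=> v w; have := fgh (cons_rV (x, v)) (cons_rV (y, w)).
suff -> : (2^-1 *: (cons_rV (x, v) + cons_rV (y, w)) =
  cons_rV ((2^-1 * (x + y))%R : T, 2^-1 *: (v + w)))%R by [].
apply/rowP => i; rewrite [LHS]mxE [X in (_ * X)%R]mxE.
by case: (unliftP ord0 i) => [j|] ->; rewrite ?cons_rVS ?cons_rV0//= !mxE.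
Qed.

Lemma measurable_affine_rV n (c : R) (v : 'rV[R]_n) :
  measurable_fun [set: 'rV[R]_n] (fun y => c *: y + v)%R.
Proof.
apply/measurable_fun_rVP => i.
rewrite (_ : _ \o _ = (fun x => c * x + v ord0 i)%R \o rV_coord i).
  apply: measurableT_comp; first exact: measurable_affine.
  exact: measurable_rV_coord.
by apply/funext => y; rewrite /rV_coord/= !mxE.
Qed.

Lemma ge0_integral_affine_rV n (c : R) (v : 'rV[R]_n) (f : 'rV[R]_n -> \bar R) :
  (0 < c)%R -> measurable_fun [set: _] f -> (forall x, 0 <= f x) ->
  \int[lebesgue_rV n]_y f (c *: y + v)%R =
  (c ^- n)%:E * \int[lebesgue_rV n]_y f y.
Proof.
move=> c0; elim: n v f => [|n IH] v f mf f0.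
  rewrite /= !integral_dirac//; last exact: measurableT_comp (measurable_affine_rV _ _).
  rewrite diracT !mul1e expr0 invr1 mul1e; congr f.
  by apply/rowP => -[].
rewrite !integral_lebesgue_rVS//; last exact: measurableT_comp (measurable_affine_rV _ _).
have step x y : (c *: cons_rV (x, y) + v = cons_rV ((c * x + v ord0 ord0)%R : T,
    c *: y + (uncons_rV v).2))%R.
  apply/rowP => i; rewrite [LHS]mxE [X in (X + _)%R]mxE.
  case: (unliftP ord0 i) => [j|] ->; rewrite ?cons_rVS ?cons_rV0//= !mxE.
  by congr (_ + v _ _)%R; exact/val_inj.
transitivity (\int[mu]_x ((c ^- n)%:E *
    \int[lebesgue_rV n]_y f (cons_rV ((c * x + v ord0 ord0)%R : T, y)))).
  apply: eq_integral => x _; rewrite -(IH (uncons_rV v).2)//.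
    by apply: eq_integral => y _; rewrite step.
  exact: measurable_fun_section.
rewrite (@ge0_integral_affine R c (v ord0 ord0)
  (fun x => (c ^- n)%:E * \int[lebesgue_rV n]_y f (cons_rV (x, y))))//.
- rewrite ge0_integralZl//; last 3 first.
  + exact: measurable_fun_marginal.
  + by move=> x _; exact: integral_ge0.
  + by rewrite lee_fin invr_ge0 exprn_ge0// ltW.
  by rewrite muleA -EFinM exprS invfM.
- by apply: measurable_funeM; exact: measurable_fun_marginal.
- move=> x; rewrite mule_ge0//; last exact: integral_ge0.
  by rewrite lee_fin invr_ge0 exprn_ge0// ltW.
Qed.

Lemma lebesgue_rV_affine n (c : R) (v : 'rV[R]_n) (A : set 'rV[R]_n) :
  (0 < c)%R -> measurable A ->
  lebesgue_rV n [set y | A (c *: y + v)%R] = (c ^- n)%:E * lebesgue_rV n A.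
Proof.
move=> c0 mA.
have mB : measurable [set y | A (c *: y + v)%R].
  by rewrite -[X in measurable X]setTI; exact: (measurable_affine_rV c v).
have indicI B : measurable B ->
    lebesgue_rV n B = \int[lebesgue_rV n]_y (\1_B y)%:E.
  by move=> ?; rewrite integral_indic// setIT.
rewrite !indicI// -(ge0_integral_affine_rV v)//.
exact/measurable_EFinP.
Qed.

End lebesgue_rV_integral.

(** * Tails and moments of the marginals *)

Section measurable_rV_sets.
Context {R : realType} {n : nat}.

Lemma measurable_dotv (t : 'rV[R]_n) :
  measurable_fun [set: 'rV[R]_n] (fun x => dotv x t : measurableTypeR R).
Proof.
apply: measurable_sum => i; apply: measurable_funM => //.
exact: measurable_rV_coord.
Qed.

(** Boxes with rational corners form a countable base of measurable open sets; they link the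
    topology, in which the support is defined, with the product sigma-algebra. *)
Definition rat_box (q : {ffun 'I_n -> rat * rat}) : set 'rV[R]_n :=
  [set x | forall i, ratr (q i).1 < x ord0 i < ratr (q i).2].

Lemma measurable_rat_box q : measurable (rat_box q).
Proof.
rewrite (_ : rat_box q = \bigcap_(i in [set: 'I_n])
    (rV_coord i @^-1` `]ratr (q i).1, ratr (q i).2[)).
  apply: fin_bigcap_measurable => // i _.
  by rewrite -[X in measurable X]setTI; exact: measurable_rV_coord.
apply/seteqP; split => [x h i _|x h i]; first by rewrite /= in_itv/=; exact: h.
by have := h i I; rewrite /= in_itv.
Qed.

Lemma open_rat_box q : open (rat_box q).
Proof.
rewrite openE => x xq; exists (fun _ i => `]ratr (q i).1, ratr (q i).2[%classic).
  move=> i j; apply: open_nbhs_nbhs; split; first exact: interval_open.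
  by rewrite (ord1 i)/= in_itv/=; exact: xq.
by move=> y yq i; have := yq ord0 i; rewrite /= in_itv.
Qed.

Lemma rat_box_nbhs (x : 'rV[R]_n) (A : set 'rV[R]_n) : nbhs x A ->
  exists2 q, rat_box q x & rat_box q `<=` A.
Proof.
move=> /nbhs_ballP[e /= e0 eA].
have H (i : 'I_n) : exists q : rat * rat,
    x ord0 i - e < ratr q.1 < x ord0 i /\ x ord0 i < ratr q.2 < x ord0 i + e.
  have [|q1 q1x] := @rat_in_itvoo R (x ord0 i - e) (x ord0 i).
    by rewrite gtrBl.
  have [|q2 q2x] := @rat_in_itvoo R (x ord0 i) (x ord0 i + e).
    by rewrite ltrDl.
  by exists (q1, q2); rewrite !in_itv/= in q1x q2x *.
have [Q QP] := choice H.
exists [ffun i => Q i]; first by move=> i; rewrite ffunE; have := QP i; lra.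
move=> y yQ; apply: eA; split => // i j; rewrite (ord1 i).
by have := yQ j; rewrite ffunE /ball/= ltr_norml; have := QP j; lra.
Qed.

Lemma measurable_rat_boxes (D : set {ffun 'I_n -> rat * rat}) :
  measurable (\bigcup_(q in D) rat_box q).
Proof.
rewrite bigcup_mkcond; apply: countable_bigcupT_measurable => // q.
by case: ifP => _ //; exact: measurable_rat_box.
Qed.

Lemma open_measurable_rV (U : set 'rV[R]_n) : open U -> measurable U.
Proof.
move=> oU; rewrite (_ : U = \bigcup_(q in [set q | rat_box q `<=` U]) rat_box q).
  exact: measurable_rat_boxes.
apply/seteqP; split => [x Ux|x [q /= qU]]; last exact: qU.
have [|q qx qU] := @rat_box_nbhs x U; first exact: open_nbhs_nbhs.
by exists q.
Qed.

Context {d : measure_display} {Omega : measurableType d}.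
Context (P : probability Omega R) (X : {RV P >-> 'rV[R]_n}).

Lemma measurable_preimage_RV (A : set 'rV[R]_n) :
  measurable A -> measurable (X @^-1` A).
Proof. by move=> mA; rewrite -[X in measurable X]setTI; exact: measurable_funP. Qed.

Let null_boxes := [set q | P (X @^-1` rat_box q) = 0%E].

Lemma rvec_support_setC :
  ~` rvec_support P X = \bigcup_(q in null_boxes) rat_box q.
Proof.
apply/seteqP; split => [x /existsNP[U]|x [q /= qN xq] /(_ _ (@open_rat_box q) xq)].
  move=> /not_implyP[oU] /not_implyP[Ux] /negP; rewrite -leNgt => PU.
  have [|q qx qU] := @rat_box_nbhs x U; first exact: open_nbhs_nbhs.
  exists q => //=; apply/eqP; rewrite eq_le measure_ge0 andbT.
  apply: le_trans PU; apply: le_measure; rewrite ?inE.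
  - by apply: measurable_preimage_RV; exact: measurable_rat_box.
  - by apply: measurable_preimage_RV; exact: open_measurable_rV.
  - exact: preimage_subset.
by rewrite qN ltxx.
Qed.

Lemma measurable_rvec_support : measurable (rvec_support P X).
Proof.
by rewrite -[rvec_support P X]setCK; apply: measurableC; rewrite rvec_support_setC;
  exact: measurable_rat_boxes.
Qed.

(** Countably many null boxes cover the complement of the support. They are enumerated through
    [unpickle], a code without a null box giving the empty set. *)
Lemma rvec_support_ae : P (X @^-1` (~` rvec_support P X)) = 0%E.
Proof.
pose F k := if unpickle k is Some q then
  if pselect (null_boxes q) then X @^-1` rat_box q else set0 else set0.
have mF k : measurable (F k).
  rewrite /F; case: (unpickle k) => [q|]; last exact: measurable0.
  case: (pselect (null_boxes q)) => ?; last exact: measurable0.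
  by apply: measurable_preimage_RV; exact: measurable_rat_box.
have F0 k : P.-negligible (F k).
  apply/negligibleP => //; rewrite /F; case: (unpickle k) => [q|]; rewrite ?measure0//.
  by case: (pselect (null_boxes q)) => [h|h]; [exact: h|exact: measure0].
have := negligible_bigcup F0; rewrite negligibleP; last exact: bigcup_measurable.
rewrite rvec_support_setC preimage_bigcup => PF0.
apply/eqP; rewrite eq_le measure_ge0 andbT -PF0.
apply: le_measure; rewrite ?inE.
- by rewrite -preimage_bigcup; apply: measurable_preimage_RV; exact: measurable_rat_boxes.
- exact: bigcup_measurable.
- move=> w [q Nq Xq]; exists (pickle q) => //; rewrite /F pickleK.
  by case: (pselect (null_boxes q)).
Qed.

End measurable_rV_sets.

Lemma dotvDl (R : realType) n (x y t : 'rV[R]_n) :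
  dotv (x + y) t = dotv x t + dotv y t.
Proof.
by rewrite /dotv -big_split/=; apply: eq_bigr => i _; rewrite mxE mulrDl.
Qed.

Lemma dotvZl (R : realType) n (c : R) (x t : 'rV[R]_n) :
  dotv (c *: x) t = c * dotv x t.
Proof.
by rewrite /dotv mulr_sumr; apply: eq_bigr => i _; rewrite mxE mulrA.
Qed.

Lemma dotvC (R : realType) n (x t : 'rV[R]_n) : dotv x t = dotv t x.
Proof. by apply: eq_bigr => i _; rewrite mulrC. Qed.

Lemma dotvDr (R : realType) n (x y t : 'rV[R]_n) :
  dotv t (x + y) = dotv t x + dotv t y.
Proof. by rewrite dotvC dotvDl !(dotvC t). Qed.

Lemma dotvZr (R : realType) n (c : R) (x t : 'rV[R]_n) :
  dotv t (c *: x) = c * dotv t x.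
Proof. by rewrite dotvC dotvZl (dotvC t). Qed.

Lemma dotvNl (R : realType) n (x t : 'rV[R]_n) : dotv (- x) t = - dotv x t.
Proof. by rewrite -scaleN1r dotvZl mulN1r. Qed.

Lemma dotvNr (R : realType) n (x t : 'rV[R]_n) : dotv x (- t) = - dotv x t.
Proof. by rewrite dotvC dotvNl dotvC. Qed.

Section tails.
Context {R : realType} {n : nat} {d : measure_display} {Omega : measurableType d}.
Context (P : probability Omega R) (X : {RV P >-> 'rV[R]_n}).

Definition tail (t : 'rV[R]_n) (a : R) : \bar R :=
  P (X @^-1` [set x | a <= `|dotv x t|]).

Lemma measurable_dotv_ge (t : 'rV[R]_n) (a : R) :
  measurable [set x : 'rV[R]_n | a <= dotv x t].
Proof.
rewrite (_ : [set _ | _] = (fun x => dotv x t : measurableTypeR R) @^-1` `[a, +oo[).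
  by rewrite -[X in measurable X]setTI; exact: measurable_dotv.
by apply/seteqP; split => x /=; rewrite in_itv/= andbT.
Qed.

Lemma measurable_normr_dotv_ge (t : 'rV[R]_n) (a : R) :
  measurable [set x : 'rV[R]_n | a <= `|dotv x t|].
Proof.
rewrite (_ : [set _ | _] = [set x : 'rV[R]_n | a <= dotv x t] `|`
    [set x | a <= dotv x (- t)]).
  by apply: measurableU; exact: measurable_dotv_ge.
apply/seteqP; split => x /=; rewrite dotvNr.
  by rewrite real_ler_normr ?num_real// => /orP[]; [left|right].
by rewrite real_ler_normr ?num_real// => -[] ->//; rewrite orbT.
Qed.

Lemma tail_fin_num t a : tail t a \is a fin_num.
Proof.
apply: fin_num_measure; apply: measurable_preimage_RV.
exact: measurable_normr_dotv_ge.
Qed.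

(** Prékopa-Leindler for the density times indicators of half-spaces: the midpoint of a point of the
    first and a point of the second lies in the third. *)
Lemma log_concave_halfspaces (t : 'rV[R]_n) (a b : R) : log_concave P X ->
  (P (X @^-1` [set x | a <= dotv x t]%R) *
   P (X @^-1` [set x | b <= dotv x t]%R) <=
   P (X @^-1` [set x | 2^-1 * (a + b) <= dotv x t]%R) *
   P (X @^-1` [set x | 2^-1 * (a + b) <= dotv x t]%R))%E.
Proof.
move=> [f [mf f0 fP] lc].
pose H (c : R) := [set x : 'rV[R]_n | c <= dotv x t].
have mH c : measurable (H c) by exact: measurable_dotv_ge.
have mS : measurable (rvec_support P X) by exact: measurable_rvec_support.
pose S := rvec_support P X.
have mSH c : measurable (S `&` H c) by exact: measurableI.
have intH (A : set 'rV[R]_n) : measurable A ->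
    (\int[lebesgue_rV n]_x (f x * \1_A x)%:E)%E = P (X @^-1` A).
  move=> mA; rewrite fP// [RHS]integral_mkcond; apply: eq_integral => x _.
  by rewrite patchE indicE; case: ifP => _; rewrite ?mulr1 ?mulr0.
(* The density inequality is available only between points of the support, so the two half-spaces on
   the left are intersected with it; the midpoint half-space is kept whole. *)
have PSH c : P (X @^-1` H c) = P (X @^-1` (S `&` H c)).
  apply/eqP; rewrite eq_le; apply/andP; split; last first.
    apply: le_measure; rewrite ?inE; try exact: measurable_preimage_RV.
    by move=> w [].
  rewrite -[leRHS]adde0 -(rvec_support_ae X).
  apply: le_trans (measureU2 _ _ _); last 2 first.
  - exact: measurable_preimage_RV.
  - by apply: measurable_preimage_RV; exact: measurableC.
  apply: le_measure; rewrite ?inE; first exact: measurable_preimage_RV.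
    apply: measurableU; apply: measurable_preimage_RV => //.
    exact: measurableC.
  by move=> w Hw; have [Sw|Sw] := pselect (S (X w)); [left|right].
have mfA (A : set 'rV[R]_n) : measurable A ->
    measurable_fun [set: 'rV[R]_n] (fun x => (f x * \1_A x)%:E).
  by move=> mA; apply/measurable_EFinP; apply: measurable_funM.
have fA0 (A : set 'rV[R]_n) x : (0 <= (f x * \1_A x)%:E)%E.
  by rewrite lee_fin mulr_ge0.
rewrite -/(H a) -/(H b) -/(H (2^-1 * (a + b))) (PSH a) (PSH b) -!intH//.
apply: prekopa_leindler => //; try exact: mfA.
move=> x y; rewrite -!EFinM lee_fin !indicE.
have [|_] := boolP (x \in _); last by rewrite mulr0 mul0r -expr2 sqr_ge0.
have [|_] := boolP (y \in _); last by rewrite !mulr0 -expr2 sqr_ge0.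
rewrite !inE => -[Sy Hy] [Sx Hx].
rewrite mem_set; last first.
  by rewrite /H/= dotvZl dotvDl ler_pM2l// lerD.
rewrite !mulr1; have := lc x y Sx Sy 2^-1.
rewrite (_ : 1 - 2^-1 = 2^-1); last by field.
rewrite !powR12_sqrt// -scalerDr => /(_ _)/wrap[]; first by lra.
move=> h; rewrite -[f x]sqr_sqrtr// -[f y]sqr_sqrtr// -exprMn -expr2.
by rewrite ler_pXn2r// nnegrE// mulr_ge0.
Qed.

Hypotheses (sX : symmetric_rvec P X) (lX : log_concave P X).

Let half t a := P (X @^-1` [set x | a <= dotv x t]).

Let half_fin_num t a : half t a \is a fin_num.
Proof.
apply: fin_num_measure; apply: measurable_preimage_RV.
exact: measurable_dotv_ge.
Qed.

(** Two opposite half-spaces, equally likely by symmetry and disjoint because [0 < a]. *)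
Lemma symmetric_tail t a : 0 < a -> tail t a = (2%:E * half t a)%E.
Proof.
move=> a0.
have mN : measurable [set x : 'rV[R]_n | dotv x t <= - a].
  rewrite (_ : [set _ | _] = [set x | a <= dotv x (- t)]).
    exact: measurable_dotv_ge.
  apply/seteqP; split => x /=; rewrite dotvNr; lra.
have halfN : P (X @^-1` [set x | dotv x t <= - a]) = half t a.
  rewrite sX//; congr (P _).
  by apply/seteqP; split => w /=; rewrite dotvNl; lra.
have -> : (2%:E * half t a = half t a + half t a)%E.
  rewrite -[half t a]fineK; last exact: half_fin_num.
  by rewrite -EFinM -EFinD; congr EFin; ring.
rewrite -{2}halfN /half -measureU;
  [|by apply: measurable_preimage_RV; exact: measurable_dotv_ge
   |exact: measurable_preimage_RV|].
  congr (P _); rewrite -preimage_setU; congr (_ @^-1` _).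
  apply/seteqP; split => x /=; rewrite real_ler_normr ?num_real//.
    by move=> /orP[->|h]; [left|right; lra].
  by move=> -[->//|h]; rewrite orbC; have -> : a <= - dotv x t by lra.
apply/seteqP; split => w //= -[]; lra.
Qed.

Lemma symmetric_half t : (1 <= 2%:E * half t 0%R)%E.
Proof.
have mN : measurable [set x : 'rV[R]_n | dotv x t <= 0].
  rewrite (_ : [set _ | _] = [set x | 0 <= dotv x (- t)]).
    exact: measurable_dotv_ge.
  apply/seteqP; split => x /=; rewrite dotvNr; lra.
have halfN : P (X @^-1` [set x | dotv x t <= 0]) = half t 0.
  rewrite sX//; congr (P _).
  by apply/seteqP; split => w /=; rewrite dotvNl; lra.
have -> : (2%:E * half t 0%R = half t 0%R + half t 0%R)%E.
  rewrite -[half t 0]fineK; last exact: half_fin_num.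
  by rewrite -EFinM -EFinD; congr EFin; ring.
rewrite -{2}halfN /half -(probability_setT P).
apply: le_trans (measureU2 _ _ _) => //; last 2 first.
- by apply: measurable_preimage_RV; exact: measurable_dotv_ge.
- exact: measurable_preimage_RV.
apply: le_measure; rewrite ?inE//.
  by apply: measurableU; apply: measurable_preimage_RV => //; exact: measurable_dotv_ge.
by move=> w _ /=; have [|/ltW] := leP 0 (dotv (X w) t); [left|right].
Qed.

(** The point [a] is the midpoint of [2 * a] and [0], so [half (2a) * half 0 <= half a ^ 2].
    Multiplying by 4 and using [half 0 >= 1/2] turns this into the inequality for two-sided
    tails. *)
Lemma tail_double t a : 0 < a -> (tail t (2 * a)%R <= tail t a * tail t a)%E.
Proof.
move=> a0; rewrite !symmetric_tail ?mulr_gt0//.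
have := @log_concave_halfspaces t (2 * a) 0 lX.
rewrite addr0 mulrA mulVf// mul1r -/(half t _) -/(half t 0) -/(half t a) => h.
have := symmetric_half t.
move: h; rewrite -[half t 0]fineK// -[half t (2 * a)]fineK// -[half t a]fineK//.
rewrite -!EFinM !lee_fin => h h1.
have : 0 <= fine (half t (2 * a)) by rewrite fine_ge0// measure_ge0.
nra.
Qed.

Lemma tail_double_iter t a k : 0 < a ->
  (tail t (2 ^+ k * a)%R <= (fine (tail t a) ^+ (2 ^ k))%:E)%E.
Proof.
move=> a0; elim: k => [|k IH].
  by rewrite expr0 mul1r expn0 expr1 fineK// tail_fin_num.
rewrite exprS -mulrA; apply: le_trans (tail_double _ _) _.
  by rewrite mulr_gt0// exprn_gt0.
rewrite expnS mulnC exprM expr2 EFinM lee_pmul//; exact: measure_ge0.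
Qed.

End tails.

Lemma Lnorm_leP (R : realType) d (T : measurableType d)
    (mu : {measure set T -> \bar R}) (f : T -> R) (p c : R) : 0 < p -> 0 <= c ->
  ('N[mu]_(p%:E)[(EFin \o f)] <= c%:E)%E <->
  (\int[mu]_x (`|f x| `^ p)%:E <= (c `^ p)%:E)%E.
Proof.
move=> p0 c0.
have -> : (\int[mu]_x (`|f x| `^ p)%:E = 'N[mu]_(p%:E)[(EFin \o f)] `^ p)%E.
  by rewrite poweR_Lnorm ?gt_eqF//; exact: eq_integral.
have := Lnorm_ge0 mu p%:E (EFin \o f).
case: ('N[mu]_(p%:E)[(EFin \o f)])%E => [r| |]//.
- rewrite poweR_EFin !lee_fin => r0; split => [rc|].
    by apply: ge0_ler_powR => //; rewrite ?nnegrE// ltW.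
  move=> h; rewrite leNgt; apply/negP => cr.
  by move: h; rewrite leNgt gt0_ltr_powR.
- by rewrite poweRyr ?gt_eqF// => _; split.
Qed.

Lemma exists_dyadic_scale (R : realType) (a z : R) : 0 < a -> a <= z ->
  exists k, 2 ^+ k * a <= z < 2 ^+ k.+1 * a.
Proof.
move=> a0 az.
have ex : exists k, z < 2 ^+ k.+1 * a.
  exists (Num.truncn (z / a)); rewrite -ltr_pdivrMr//.
  apply: lt_le_trans (truncnS_gt _) _.
  by rewrite -natrX ler_nat; exact/ltnW/ltn_expl.
case: (ex_minnP ex) => k zk mink; exists k; rewrite zk andbT.
case: k zk mink => [|k] zk mink; first by rewrite expr0 mul1r.
by rewrite leNgt; apply/negP => /mink; rewrite ltnn.
Qed.

Section moments.
Context {R : realType} {n : nat} {d : measure_display} {Omega : measurableType d}.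
Context (P : probability Omega R) (X : {RV P >-> 'rV[R]_n}).
Hypotheses (sX : symmetric_rvec P X) (lX : log_concave P X).
Variable p : R.
Hypothesis p1 : 1 <= p.

Let p0 : 0 < p. Proof. exact: lt_le_trans p1. Qed.

Definition Lp_norm (t : 'rV[R]_n) : \bar R :=
  ('N[P]_(p%:E)[(fun w => (dotv (X w) t)%:E)])%E.

Let marginal t w := dotv (X w) t.

Let mmarginal t : measurable_fun [set: Omega] (marginal t).
Proof.
apply: (measurableT_comp (measurable_dotv t)); exact: measurable_funP.
Qed.

Let mpow t : measurable_fun [set: Omega] (fun w => (`|marginal t w| `^ p)%:E).
Proof.
apply/measurable_EFinP.
apply: (@measurableT_comp _ _ _ _ _ _ (fun x : R => x `^ p)) => //.
exact: measurableT_comp.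
Qed.

(** With [y = 2 ^+ k] the left side is [(2 y a exp(-y/2))^p]. As [exp(y/2) >= (y/4)^2], it is at
    most [(32 a / y)^p], and [p >= 1] replaces [y^-p] by [y^-1]. The right side is written as the
    term of a geometric series that [epsilon_trick0] sums. *)
Lemma dyadic_weight_bound (a : R) (k : nat) : 0 < a ->
  (2 ^+ k.+1 * a) `^ p * expR (- (p / 2)) ^+ (2 ^ k) <=
  2 * (32 * a) `^ p / (2 ^ k.+1)%:R.
Proof.
move=> a0; pose y : R := 2 ^+ k.
have y0 : 0 < y by rewrite exprn_gt0.
have y1 : 1 <= y by rewrite exprn_ege1// ler1n.
have -> : expR (- (p / 2)) ^+ (2 ^ k) = expR (- (y / 2)) `^ p.
  by rewrite -expRM_natl -expRM; congr expR; rewrite natrX -/y; field.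
rewrite -powRM ?expR_ge0//; last by rewrite mulr_ge0 ?exprn_ge0// ltW.
have -> : 2 * (32 * a) `^ p / (2 ^ k.+1)%:R = y^-1 * (32 * a) `^ p.
  rewrite natrX exprS -/y; field; lra.
apply: le_trans (ge1r_powRZ _ _ p1); last 2 first.
- by rewrite invr_gt0 y0/= invf_le1.
- by rewrite mulr_ge0// ltW.
apply: ge0_ler_powR; rewrite ?nnegrE//; first exact: ltW.
- by rewrite mulr_ge0 ?expR_ge0// mulr_ge0 ?exprn_ge0// ltW.
- by rewrite mulr_ge0 ?invr_ge0 ?mulr_ge0// ltW.
rewrite exprS -/y expRN.
have e4 : y / 4 <= expR (y / 4) by have := expR_ge1Dx (y / 4); lra.
have -> : y / 2 = 2%:R * (y / 4) by field.
rewrite expRM_natl; set e := expR (y / 4) in e4 *.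
have e0 : 0 < e by exact: expR_gt0.
rewrite ler_pdivrMr ?exprn_gt0//.
rewrite -[leRHS]mulrA ler_pdivlMl//.
have : (y / 4) ^+ 2 <= e ^+ 2 by rewrite ler_pXn2r// nnegrE ltW// divr_gt0.
have -> : (y / 4) ^+ 2 = y ^+ 2 / 16 by field.
move=> h; have -> : y * (2 * y * a) = (32 * a) * (y ^+ 2 / 16) by field.
by rewrite ler_pM2l// mulr_gt0.
Qed.

(** Each doubling of the scale squares the tail bound but multiplies the [p]-th power only by [2^p].
    Since the starting value is itself a [p]-th power, the resulting constant is free of [p]. *)
Lemma Lp_norm_le_tail t a : 0 < a ->
  (tail X t a <= (expR (- (p / 2)))%:E)%E -> (Lp_norm t <= (96 * a)%:E)%E.
Proof.
move=> a0 ta; apply/Lnorm_leP => //; first by rewrite mulr_ge0// ltW.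
pose B k := X @^-1` [set x | 2 ^+ k * a <= `|dotv x t|].
have mB k : measurable (B k).
  by apply: measurable_preimage_RV; exact: measurable_normr_dotv_ge.
pose u k w : \bar R := ((2 ^+ k.+1 * a) `^ p * \1_(B k) w)%:E.
have u0 k w : (0 <= u k w)%E by rewrite lee_fin mulr_ge0// powR_ge0.
have mu k : measurable_fun [set: Omega] (u k).
  by apply/measurable_EFinP; apply: measurable_funM.
have msum : measurable_fun [set: Omega] (fun w => \sum_(k <oo) u k w)%E.
  by apply: ge0_emeasurable_sum.
have pw w : ((`|marginal t w| `^ p)%:E <= (a `^ p)%:E + \sum_(k <oo) u k w)%E.
  have [za|az] := ltP `|marginal t w| a.
    apply: (@le_trans _ _ (a `^ p)%:E).
      by rewrite lee_fin ge0_ler_powR ?nnegrE// ltW.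
    by rewrite leeDl// nneseries_ge0.
  have [k /andP[kz zk]] := exists_dyadic_scale a0 az.
  apply: (@le_trans _ _ (\sum_(k <oo) u k w)%E); last first.
    by rewrite leeDr// lee_fin powR_ge0.
  apply: le_trans (@nneseries_lim_ge _ _ _ 0%N k.+1 _) => //.
  rewrite big_nat_recr//= -[leLHS]add0e; apply: leeD; first exact: sume_ge0.
  rewrite lee_fin indicE mem_set// mulr1 ge0_ler_powR ?nnegrE//; last exact: ltW.
  - exact: ltW.
  - by rewrite mulr_ge0 ?exprn_ge0// ltW.
apply: (@le_trans _ _ (\int[P]_w ((a `^ p)%:E + \sum_(k <oo) u k w))%E).
  apply: ge0_le_integral => //.
  - exact: mpow.
  - exact: emeasurable_funD.
  - by move=> w _; exact: pw.
rewrite ge0_integralD//; [|by move=> w _; rewrite lee_fin powR_ge0|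
  by move=> w _; exact: nneseries_ge0].
rewrite integral_cst// [X in (_ * X)%E](_ : _ = 1%E); last exact: probability_setT.
rewrite mule1 integral_nneseries//.
have Iu k : (\int[P]_w u k w <= (2 * (32 * a) `^ p / (2 ^ k.+1)%:R)%:E)%E.
  have -> : (\int[P]_w u k w = ((2 ^+ k.+1 * a) `^ p)%:E * tail X t (2 ^+ k * a)%R)%E.
    under eq_integral do rewrite /u EFinM.
    rewrite ge0_integralZl//; [|exact/measurable_EFinP|by rewrite lee_fin powR_ge0].
    by rewrite integral_indic// setIT.
  apply: (@le_trans _ _ ((2 ^+ k.+1 * a) `^ p * expR (- (p / 2)) ^+ (2 ^ k))%:E).
    rewrite EFinM lee_pmul2l ?lte_fin ?powR_gt0 ?mulr_gt0 ?exprn_gt0//.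
    apply: le_trans (tail_double_iter sX lX _ _ a0) _; rewrite lee_fin.
    have t0 : 0 <= fine (tail X t a) by rewrite fine_ge0// measure_ge0.
    rewrite lerXn2r ?nnegrE ?expR_ge0//.
    by rewrite -lee_fin fineK// tail_fin_num.
  by rewrite lee_fin dyadic_weight_bound.
have W0 : 0 <= 2 * (32 * a) `^ p by rewrite mulr_ge0// powR_ge0.
apply: (@le_trans _ _ ((a `^ p)%:E + (2 * (32 * a) `^ p)%:E)%E).
  rewrite leeD2l//; apply: le_trans (epsilon_trick0 xpredT W0).
  by apply: lee_nneseries => // k _ _; exact: integral_ge0.
(* The total [a^p + 2 (32 a)^p] is at most [3 (32 a)^p], and [p >= 1] moves the 3 inside the power;
   hence 96. *)
rewrite lee_fin (_ : 96 * a = 3 * (32 * a)); last by field.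
apply: le_trans (le1r_powRZ _ _ p1); rewrite ?ler1n//; last by rewrite mulr_ge0// ltW.
have : a `^ p <= (32 * a) `^ p.
  apply: ge0_ler_powR; rewrite ?nnegrE ?mulr_ge0 ?(ltW a0) ?(ltW p0)//.
  by rewrite ler_peMl ?(ltW a0)// ler1n.
lra.
Qed.

Lemma tail_cvg0 t (e : R) : 0 < e -> exists2 a, 0 < a & (tail X t a <= e%:E)%E.
Proof.
move=> e0; pose F k := X @^-1` [set x | k%:R <= `|dotv x t|].
have mF k : measurable (F k).
  by apply: measurable_preimage_RV; exact: measurable_normr_dotv_ge.
have F0 : \bigcap_k F k = set0.
  apply/seteqP; split => // w /(_ (Num.truncn `|dotv (X w) t|).+1 I).
  by rewrite /F/= leNgt truncnS_gt.
have := @nonincreasing_cvg_mu _ _ _ P F.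
rewrite F0 measure0 => /(_ _ mF measurable0 _)/wrap[||].
- by rewrite (le_lt_trans (probability_le1 _ _)) ?ltry.
- move=> i j ij; apply/subsetPset => w; rewrite /F/=.
  by apply: le_trans; rewrite ler_nat.
move=> /fine_cvgP[_ /cvgrPdist_le/(_ _ e0)[k _ kP]].
exists k.+1%:R; first by rewrite ltr0n.
have := kP k.+1 (leqnSn k); rewrite sub0r normrN ger0_norm ?fine_ge0 ?measure_ge0//= => h.
by rewrite -[tail _ _ _]fineK ?tail_fin_num// lee_fin.
Qed.

(** Finiteness of the moment is a consequence of log-concavity and symmetry: some scale has tail at
    most [exp(-p/2)], and the tail bound applies there. *)
Lemma Lp_norm_lty t : (Lp_norm t < +oo)%E.
Proof.
have [a a0 ta] := @tail_cvg0 t (expR (- (p / 2))) (expR_gt0 _).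
by apply: le_lt_trans (Lp_norm_le_tail a0 ta) _; rewrite ltry.
Qed.

(** Otherwise the norm would be at most 96/192, which is less than 1. *)
Lemma tail_ge_small_ball t : Lp_norm t = 1%E ->
  ((expR (- (p / 2)))%:E <= tail X t 192^-1)%E.
Proof.
move=> t1; rewrite leNgt; apply/negP => /ltW /Lp_norm_le_tail.
rewrite t1 => /(_ _)/wrap[]; first by rewrite invr_gt0.
by rewrite lee_fin; lra.
Qed.

Lemma expR1_le4 : expR 1 <= 4 :> R.
Proof.
have := expR_ge1Dx (- 2^-1 : R); rewrite expRN => h.
have e0 := expR_gt0 (2^-1 : R).
have : expR 2^-1 <= 2 :> R.
  have : expR 2^-1 * (1 - 2^-1) <= 1 :> R.
    by rewrite -[leRHS](mulfV (lt0r_neq0 e0)) ler_pM2l.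
  by lra.
have -> : expR 1 = expR 2^-1 ^+ 2 :> R by rewrite -expRM_natl mulfV.
by rewrite expr2 => ?; nra.
Qed.

(** Markov's inequality at level 4, where [z <= z^p], gives a tail of at most 1/4, hence at most
    [exp(-1)]; iterated doubling does the rest. *)
Lemma tail_le_exp t k : (Lp_norm t <= 1)%E ->
  (tail X t (2 ^+ k * 4)%R <= (expR (- 2 ^+ k))%:E)%E.
Proof.
move=> t1.
have t4 : (tail X t 4 <= (expR (- 1))%:E)%E.
  move/Lnorm_leP : t1 => /(_ p0 ler01); rewrite powR1 => I1.
  pose B := X @^-1` [set x | 4 <= `|dotv x t|].
  have mB : measurable B.
    by apply: measurable_preimage_RV; exact: measurable_normr_dotv_ge.
  have : (4%:E * tail X t 4 <= 1)%E.
    apply: le_trans I1; rewrite -[tail _ _ _]/(P B).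
    have -> : (4%:E * P B = \int[P]_w (4 * \1_B w)%:E)%E.
      under eq_integral do rewrite EFinM.
      rewrite ge0_integralZl//; last exact/measurable_EFinP.
      by rewrite integral_indic// setIT.
    apply: ge0_le_integral => //.
    - by apply/measurable_EFinP; apply: measurable_funM.
    - exact: mpow.
    move=> w _; rewrite lee_fin indicE; have [|_] := boolP (_ \in _); last first.
      by rewrite mulr0 powR_ge0.
    rewrite inE mulr1 /B/= => h; apply: (le_trans h).
    by apply: le1r_powR => //; apply: le_trans h; rewrite ler1n.
  rewrite -[tail _ _ _]fineK ?tail_fin_num// -EFinM !lee_fin => h.
  have t0 : 0 <= fine (tail X t 4) by rewrite fine_ge0// measure_ge0.
  rewrite expRN -[leRHS]mul1r ler_pdivlMr ?expR_gt0//.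
  by have := expR1_le4; nra.
apply: le_trans (tail_double_iter sX lX _ _ _) _ => //.
rewrite lee_fin (_ : - 2 ^+ k = (2 ^ k)%:R * (- 1)); last first.
  by rewrite natrX mulrN1.
rewrite expRM_natl lerXn2r ?nnegrE ?expR_ge0 ?fine_ge0 ?measure_ge0//.
by rewrite -lee_fin fineK// tail_fin_num.
Qed.

End moments.

(** * Deviation inequalities for independent copies *)

Lemma measure_bigsetU_le d (T : measurableType d) (R : realType)
    (mu : {measure set T -> \bar R}) (I : finType) (Q : pred I) (F : I -> set T) :
  (forall i, measurable (F i)) ->
  (mu (\big[setU/set0]_(i | Q i) F i) <= \sum_(i | Q i) mu (F i))%E.
Proof.
move=> mF.
suff [] : measurable (\big[setU/set0]_(i | Q i) F i) /\
  (mu (\big[setU/set0]_(i | Q i) F i) <= \sum_(i | Q i) mu (F i))%E by [].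
elim/big_rec2 : _ => [|i y A _ [mA Ay]]; first by rewrite measure0.
split; first exact: measurableU.
by apply: le_trans (measureU2 _ _ _) _ => //; exact: leeD.
Qed.

Lemma sub_bigsetU (T : Type) (I : finType) (Q : pred I) (F : I -> set T) i :
  Q i -> F i `<=` \big[setU/set0]_(j | Q j) F j.
Proof. by move=> Qi x Fx; rewrite (bigD1 i)//=; left. Qed.

Section independent_levels.
Context {R : realType} {n N : nat} {d : measure_display}.
Context {Omega : measurableType d} {P : probability Omega R}.
Context (Xs : 'I_N -> {RV P >-> 'rV[R]_n}).
Hypothesis indep : mutually_independent P (fun i => Xs i : Omega -> 'rV[R]_n).

Definition level_event (K : finType) (E : K -> set 'rV[R]_n)
    (c : {ffun 'I_N -> K}) : set Omega :=
  \bigcap_(i in [set` [set: 'I_N]%SET]) Xs i @^-1` E (c i).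

(** The sets [E k] may overlap: the event occurs as soon as one assignment of levels compatible with
    all the copies has product at least [r]. *)
Definition heavy_event (K : finType) (E : K -> set 'rV[R]_n) (s : K -> R)
    (r : R) : set Omega :=
  \big[setU/set0]_(c : {ffun 'I_N -> K} | r <= \prod_i s (c i)) level_event E c.

Lemma measurable_level_event (K : finType) (E : K -> set 'rV[R]_n) c :
  (forall k, measurable (E k)) -> measurable (level_event E c).
Proof.
move=> mE; apply: fin_bigcap_measurable; first exact: finite_finset.
by move=> i _; exact: measurable_preimage_RV.
Qed.

Lemma measurable_heavy_event (K : finType) (E : K -> set 'rV[R]_n) s r :
  (forall k, measurable (E k)) -> measurable (heavy_event E s r).
Proof.
by move=> mE; apply: bigsetU_measurable => c _; exact: measurable_level_event.
Qed.

(* Markov's inequality for [\prod_i s (level of X_i)], expanded over the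
   finitely many level configurations. *)
Lemma heavy_event_le (K : finType) (E : K -> set 'rV[R]_n) (s w : K -> R) (r : R) :
  (forall k, measurable (E k)) -> (forall k, 0 <= s k) -> 0 < r ->
  (forall i k, (P (Xs i @^-1` E k) <= (w k)%:E)%E) ->
  (P (heavy_event E s r) <= ((\sum_k s k * w k) ^+ N / r)%:E)%E.
Proof.
move=> mE s0 r0 Pw.
have w0 k : (0 < N)%N -> 0 <= w k.
  move=> N0; rewrite -lee_fin; apply: le_trans (Pw (Ordinal N0) k).
  exact: measure_ge0.
have w0' (c : {ffun 'I_N -> K}) i : 0 <= w (c i).
  by apply: w0; apply: leq_trans (ltn_ord i).
apply: le_trans (@measure_bigsetU_le _ _ _ P _ _ _ _) _.
  by move=> c; exact: measurable_level_event.
apply: (@le_trans _ _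
    (\sum_(c : {ffun 'I_N -> K} | r <= \prod_i s (c i)) \prod_i w (c i))%:E).
  rewrite -sumEFin; apply: lee_sum => c _.
  have /= := @indep [set: 'I_N]%SET (fun i => E (c i)) (fun i => mE (c i)).
  rewrite -[X in P X]/(level_event E c) => ->.
  under eq_bigl do rewrite inE.
  have fin i : P (Xs i @^-1` E (c i)) \is a fin_num.
    by apply: fin_num_measure; exact: measurable_preimage_RV.
  under eq_bigr do rewrite -(fineK (fin _)).
  rewrite prodEFin lee_fin; apply: ler_prod => i _.
  by rewrite fine_ge0 ?measure_ge0//= -lee_fin fineK.
rewrite lee_fin ler_pdivlMr//.
have -> : (\sum_k s k * w k) ^+ N =
    \sum_(c : {ffun 'I_N -> K}) \prod_i (s (c i) * w (c i)).
  by rewrite -(bigA_distr_bigA (fun (_ : 'I_N) k => s k * w k))/= prodr_const card_ord.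
rewrite big_mkcond/= mulr_suml; apply: ler_sum => c _.
rewrite big_split/=; case: ifPn => [rs|_]; last first.
  by rewrite mul0r mulr_ge0// prodr_ge0.
by rewrite mulrC ler_wpM2r// prodr_ge0.
Qed.

Lemma not_heavy_event (K : finType) (E : K -> set 'rV[R]_n) (s : K -> R) (r : R)
    (c : 'I_N -> K) x : ~ heavy_event E s r x ->
  (forall i, E (c i) (Xs i x)) -> \prod_i s (c i) < r.
Proof.
move=> nh Ec; rewrite ltNge; apply/negP => rs; apply: nh.
apply: (@sub_bigsetU _ _ _ _ [ffun i => c i]).
  by under eq_bigr do rewrite ffunE.
by move=> i _; rewrite /= ffunE.
Qed.

Lemma expR1_ge2 : 2 <= expR 1 :> R.
Proof. by have := expR_ge1Dx (1 : R); lra. Qed.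

(** Chernoff's bound with weight [exp(-1)] on [A] and 1 off it, so that the product of weights is
    [exp] of minus the count. One factor has mean at most [1 - g/2 <= exp(-q/2)]; comparing with
    [r = exp(-qN/4)] leaves [exp(-qN/4)]. *)
Lemma many_large (A : set 'rV[R]_n) (q : R) : measurable A ->
  (forall i, (q%:E <= P (Xs i @^-1` A))%E) ->
  (forall i j, P (Xs i @^-1` A) = P (Xs j @^-1` A)) ->
  exists B : set Omega, [/\ measurable B,
    (P B <= (expR (- (q * N%:R / 4)))%:E)%E &
    forall x, ~ B x ->
      q * N%:R / 4 < \sum_(i < N) (`[< A (Xs i x) >] : nat)%:R].
Proof.
move=> mA qA eqA.
have [N0|N0] := posnP N.
  exists setT; split; [by []| |by move=> x /(_ I)].
  rewrite N0 mulr0 mul0r oppr0 expR0; exact: probability_le1.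
(* The weights must bound the probabilities of both [A] and its complement from above, so they use
   the common exact value [g] instead of the lower bound [q]. *)
pose i0 := Ordinal N0; pose g := fine (P (Xs i0 @^-1` A)).
have mXA i : measurable (Xs i @^-1` A) by exact: measurable_preimage_RV.
have Pg i : P (Xs i @^-1` A) = g%:E.
  by rewrite /g fineK; [exact: eqA|exact: fin_num_measure].
have qg : q <= g by rewrite -lee_fin -(Pg i0).
have g0 : 0 <= g by rewrite -lee_fin -(Pg i0) measure_ge0.
pose E (b : bool) := if b then A else ~` A.
pose s (b : bool) : R := if b then expR (- 1) else 1.
pose w (b : bool) : R := if b then g else 1 - g.
pose r : R := expR (- (q * N%:R / 4)).
have mE b : measurable (E b) by case: b => //=; exact: measurableC.
exists (heavy_event E s r); split.
- exact: measurable_heavy_event.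
- apply: le_trans (@heavy_event_le _ E s w r mE _ (expR_gt0 _) _) _.
  + by case=> //=; rewrite expR_ge0.
  + move=> i []; first by rewrite Pg.
    change (P (~` (Xs i @^-1` A)) <= (1 - g)%:E)%E; rewrite probability_setC//.
    by rewrite Pg -EFinB.
  rewrite lee_fin ler_pdivrMr ?expR_gt0// -expRD big_bool/= mul1r.
  apply: (@le_trans _ _ (expR (- (q / 2)) ^+ N)); last first.
    by rewrite -expRM_natl ler_expR; lra.
  have e2 : expR (- 1) <= 2^-1 :> R.
    by rewrite expRN lef_pV2 ?posrE ?expR_gt0// expR1_ge2.
  have e0 := expR_ge0 (- 1 : R).
  have g1 : g <= 1 by rewrite -lee_fin -(Pg i0) probability_le1.
  apply: lerXn2r; rewrite ?nnegrE ?expR_ge0//; first by nra.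
  apply: le_trans (expR_ge1Dx _); nra.
- move=> x nB.
  have := @not_heavy_event _ E s r (fun i => `[< A (Xs i x) >]) x nB.
  have H i : E `[< A (Xs i x) >] (Xs i x) by rewrite /E; case: asboolP.
  move=> /(_ H).
  have -> : \prod_i s `[< A (Xs i x) >] =
      expR (- \sum_(i < N) (`[< A (Xs i x) >] : nat)%:R).
    rewrite -sumrN expR_sum; apply: eq_bigr => i _; rewrite /s.
    by case: asboolP; rewrite ?oppr0 ?expR0.
  by rewrite ltr_expR ltrN2.
Qed.

(** [heavy_event] allows finitely many levels only. Level 0 carries no lower bound and receives the
    values up to 4; the top level [K] carries no upper bound. *)
Lemma dyadic_level (K : nat) (z : R) :
  exists k : 'I_K.+1, ((k == 0 :> nat) || (2 ^+ k.-1 * 4 <= z)) /\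
    ((z <= 2 ^+ k * 4) \/ k = K :> nat).
Proof.
have [z4|z4] := leP z 4.
  by exists ord0; split => //; left; rewrite expr0 mul1r.
have [j /andP[jz zj]] := @exists_dyadic_scale R 4 z ltac:(lra) (ltW z4).
have [jK|Kj] := ltnP j K.
  have jK' : (j.+1 < K.+1)%N by [].
  by exists (Ordinal jK'); split => /=; [|left; exact: ltW].
exists ord_max; split; last by right.
case: K Kj => [//|K Kj] /=; apply: le_trans jz.
by rewrite ler_pM2r// ler_weXn2l ?ler1n// ltnW.
Qed.

(** Bounds the exponential moment of one copy. The term of index [i + 1] is
    [exp(-2^i / 2) <= 2 / 2^i], so the sum stays below 8 whatever [K] is; this matters because [K]
    will grow with [N]. *)
Lemma sum_dyadic_weights (K : nat) :
  \sum_(k < K.+1) expR (2 ^+ k / 4) *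
    (if k == 0 :> nat then 1 else expR (- 2 ^+ k.-1)) <= expR 3 :> R.
Proof.
have e3 : 8 <= expR 3 :> R.
  have -> : (3 : R) = 3%:R * 1 by rewrite mulr1.
  rewrite expRM_natl; have -> : (8 : R) = 2 ^+ 3 by rewrite -natrX.
  by rewrite lerXn2r ?nnegrE ?expR_ge0// expR1_ge2.
apply: le_trans e3.
rewrite big_ord_recl /= expr0 mulr1.
have e14 : expR (1 / 4) <= 4 :> R.
  by apply: le_trans (@expR1_le4 R); rewrite ler_expR; lra.
suff : \sum_(i < K) expR (2 ^+ (lift ord0 i) / 4) * expR (- 2 ^+ i) <=
    4 * (1 - 2^-1 ^+ K) :> R.
  have : 0 <= 2^-1 ^+ K :> R by rewrite exprn_ge0.
  lra.
elim: K => [|K IH]; first by rewrite big_ord0 expr0 subrr mulr0.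
rewrite big_ord_recr/=.
have step : expR (2 ^+ (bump 0 K) / 4) * expR (- 2 ^+ K) <= 2 * 2^-1 ^+ K :> R.
  rewrite -expRD /bump leq0n add1n exprS.
  have -> : 2 * 2 ^+ K / 4 - 2 ^+ K = - (2 ^+ K / 2) :> R by field.
  rewrite expRN; have y0 : 0 < 2 ^+ K :> R by rewrite exprn_gt0.
  have -> : 2 * 2^-1 ^+ K = (2 ^+ K / 2)^-1 :> R.
    by rewrite exprVn; field; lra.
  rewrite lef_pV2 ?posrE ?expR_gt0 ?divr_gt0//.
  by have := expR_ge1Dx (2 ^+ K / 2 : R); lra.
apply: le_trans (lerD (IH) step) _.
by rewrite exprS; lra.
Qed.

(** Chernoff's bound with weights [exp(2^k / 4)]: the probability is at most [exp(3N) / exp(6N)],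
    and off the event the numbers [2^(c i)] add up to less than [24 N], whence 96 after multiplying
    by 4. *)
Lemma sum_bounded (u : 'rV[R]_n) :
  (forall i k, (P (Xs i @^-1` [set x | (2 ^+ k * 4 <= `|dotv x u|)%R]) <=
    (expR (- 2 ^+ k))%:E)%E) ->
  exists B : set Omega, [/\ measurable B, (P B <= (expR (- (3 * N%:R)))%:E)%E &
    forall x, ~ B x -> \sum_(i < N) `|dotv (Xs i x) u| <= 96 * N%:R].
Proof.
move=> Pu.
(* Off the event a single [2^(c i)] is below [24 N], hence below [2^K], so no copy sits in the
   unbounded top level. *)
pose K := (24 * N)%N.
pose E (k : 'I_K.+1) := [set x : 'rV[R]_n |
  (k == 0 :> nat) || (2 ^+ k.-1 * 4 <= `|dotv x u|)].
pose s (k : 'I_K.+1) : R := expR (2 ^+ k / 4).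
pose w (k : 'I_K.+1) : R := if k == 0 :> nat then 1 else expR (- 2 ^+ k.-1).
pose r : R := expR (6 * N%:R).
have mE k : measurable (E k).
  rewrite /E; case: eqP => _ /=; last exact: measurable_normr_dotv_ge.
  by rewrite (_ : [set _ | _] = setT)//; apply/seteqP; split.
exists (heavy_event E s r); split.
- exact: measurable_heavy_event.
- apply: le_trans (@heavy_event_le _ E s w r mE _ (expR_gt0 _) _) _.
  + by move=> k; exact: expR_ge0.
  + move=> i k; rewrite /w; case: ifPn => k0.
      by apply: probability_le1; apply: measurable_preimage_RV; exact: mE.
    by rewrite /E (negbTE k0); exact: Pu.
  rewrite lee_fin ler_pdivrMr ?expR_gt0// -expRD.
  apply: (@le_trans _ _ (expR 3 ^+ N)); last by rewrite -expRM_natl ler_expR; lra.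
  apply: lerXn2r; rewrite ?nnegrE ?expR_ge0//; last exact: sum_dyadic_weights.
  apply: sumr_ge0 => k _; rewrite mulr_ge0 ?expR_ge0// /w.
  by case: ifP; rewrite ?expR_ge0.
- move=> x nB.
  have [c cP] := choice (fun i : 'I_N => dyadic_level K `|dotv (Xs i x) u|).
  have := @not_heavy_event _ E s r c x nB (fun i => (cP i).1).
  rewrite /s -expR_sum ltr_expR -mulr_suml => sumc.
  have cK i : `|dotv (Xs i x) u| <= 2 ^+ (c i) * 4.
    have [//|ciK] := (cP i).2.
    have : 2 ^+ (c i) <= \sum_(j < N) 2 ^+ (c j) :> R.
      rewrite (bigD1 i)//= lerDl sumr_ge0// => j _; exact: exprn_ge0.
    have : K%:R < 2 ^+ (c i) :> R by rewrite ciK -natrX ltr_nat ltn_expl.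
    by rewrite /K natrM; lra.
  apply: le_trans (ler_sum _ (fun i _ => cK i)) _.
  by rewrite -mulr_suml; lra.
Qed.

End independent_levels.

(** * Volumetric nets *)

Lemma measurable_box (R : realType) n (A : 'I_n -> set (measurableTypeR R)) :
  (forall i, measurable (A i)) ->
  measurable [set v : 'rV[R]_n | forall i, A i (v ord0 i)].
Proof.
move=> mA; rewrite (_ : [set _ | _] =
    \bigcap_(i in [set: 'I_n]) (rV_coord i @^-1` A i)).
  apply: fin_bigcap_measurable => // i _.
  by rewrite -[X in measurable X]setTI; exact: measurable_rV_coord.
by apply/seteqP; split => [v h i _|v h i]; exact: h.
Qed.

Lemma ler_coord_norm (R : realType) n (x : 'rV[R]_n) i : `|x ord0 i| <= `|x|.
Proof.
rewrite [leRHS]/Num.norm/= mx_normrE.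
by apply/bigmax_geP; right => /=; exists (ord0, i).
Qed.

Lemma ler_norm_coord (R : realType) n (x : 'rV[R]_n) (c : R) : 0 <= c ->
  (forall i, `|x ord0 i| <= c) -> `|x| <= c.
Proof.
move=> c0 xc; rewrite [leLHS]/Num.norm/= mx_normrE.
by apply/bigmax_leP; split => // -[i j] _ /=; rewrite (ord1 i).
Qed.

Section nets.
Context {R : realType} {n : nat}.
Variable nm : 'rV[R]_n -> R.
Hypothesis nmD : forall x y, nm (x + y) <= nm x + nm y.
Hypothesis nmZ : forall c x, nm (c *: x) = `|c| * nm x.
Variables m M : R.
Hypotheses (m0 : 0 < m) (M0 : 0 < M).
Hypothesis nm_ge : forall x, m * `|x| <= nm x.
Hypothesis nm_le : forall x, nm x <= M * `|x|.

Let nmN x : nm (- x) = nm x.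
Proof. by rewrite -scaleN1r nmZ normrN1 mul1r. Qed.

Definition norm_ball (x : 'rV[R]_n) (r : R) := [set y | nm (y - x) < r].

Lemma open_norm_ball x r : open (norm_ball x r).
Proof.
rewrite openE => y /= yr; apply/nbhs_ballP.
exists ((r - nm (y - x)) / M) => /=; first by rewrite divr_gt0// subr_gt0.
move=> z; rewrite mx_norm_ball /ball_/= ltr_pdivlMr// => yz.
rewrite /norm_ball/= (_ : z - x = (z - y) + (y - x)); last by rewrite addrA subrK.
apply: le_lt_trans (nmD _ _) _; rewrite -ltrBrDr.
by apply: le_lt_trans (nm_le _) _; rewrite mulrC distrC.
Qed.

Lemma measurable_norm_ball x r : measurable (norm_ball x r).
Proof. by apply: open_measurable_rV; exact: open_norm_ball. Qed.

Let V : \bar R := lebesgue_rV n (norm_ball 0 1).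

Lemma lebesgue_norm_ball x r : 0 < r ->
  lebesgue_rV n (norm_ball x r) = ((r ^+ n)%:E * V)%E.
Proof.
move=> r0; have := lebesgue_rV_affine x r0 (measurable_norm_ball x r).
have -> : [set y | norm_ball x r (r *: y + x)] = norm_ball 0 1.
  apply/seteqP; split => y; rewrite /norm_ball/= addrK subr0 nmZ gtr0_norm//.
    by rewrite gtr_pMr.
  by rewrite gtr_pMr.
rewrite /V => ->; rewrite muleA -EFinM mulfV ?mul1e//.
by rewrite gt_eqF// exprn_gt0.
Qed.

Lemma lebesgue_unit_ball_gt0 : (0 < V)%E.
Proof.
pose A (i : 'I_n) : set (measurableTypeR R) := `[- (M^-1 / 2), M^-1 / 2]%classic.
have iM0 : 0 < M^-1 / 2 by rewrite divr_gt0 ?invr_gt0.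
have LA : (0 < lebesgue_rV n [set v | forall i, A i (v ord0 i)])%E.
  rewrite lebesgue_rV_box; last by move=> i; exact: measurable_itv.
  rewrite (eq_bigr (fun=> (M^-1)%:E)) => [|i _].
    by rewrite prodEFin lte_fin prodr_gt0// => i _; rewrite invr_gt0.
  rewrite lebesgue_measure_itv/= lte_fin ifT; last by lra.
  by rewrite -EFinB; congr EFin; lra.
apply: lt_le_trans LA _; apply: le_measure; rewrite ?inE.
- by apply: measurable_box => i; exact: measurable_itv.
- exact: measurable_norm_ball.
- move=> v Av; rewrite /norm_ball/= subr0; apply: le_lt_trans (nm_le _) _.
  have vM : `|v| <= M^-1 / 2.
    apply: ler_norm_coord; first exact: ltW.
    by move=> i; have := Av i; rewrite /A/= in_itv/= ler_norml.
  rewrite -[ltRHS](mulfV (lt0r_neq0 M0)) ltr_pM2l//.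
  by apply: le_lt_trans vM _; lra.
Qed.

Lemma lebesgue_unit_ball_lty : (V < +oo)%E.
Proof.
pose A (i : 'I_n) : set (measurableTypeR R) := `[- m^-1, m^-1]%classic.
have im0 : 0 < m^-1 by rewrite invr_gt0.
have LA : (lebesgue_rV n [set v | forall i, A i (v ord0 i)] < +oo)%E.
  rewrite lebesgue_rV_box; last by move=> i; exact: measurable_itv.
  rewrite (eq_bigr (fun=> (2 * m^-1)%:E)) => [|i _]; first by rewrite prodEFin ltry.
  rewrite lebesgue_measure_itv/= lte_fin ifT; last by lra.
  by rewrite -EFinB; congr EFin; lra.
apply: le_lt_trans LA; apply: le_measure; rewrite ?inE.
- exact: measurable_norm_ball.
- by apply: measurable_box => i; exact: measurable_itv.
- move=> v; rewrite /norm_ball/= subr0 => v1 i; rewrite /A/= in_itv/= -ler_norml.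
  apply: le_trans (ler_coord_norm _ _) _.
  rewrite -[leRHS]mul1r ler_pdivlMr// mulrC.
  by apply: le_trans (nm_ge v) _; exact: ltW.
Qed.

Lemma lebesgue_separated (e : R) (s : seq 'rV[R]_n) : 0 < e ->
  pairwise (fun x y => e < nm (x - y)) s ->
  measurable (\big[setU/set0]_(x <- s) norm_ball x (e / 2)) /\
  lebesgue_rV n (\big[setU/set0]_(x <- s) norm_ball x (e / 2)) =
    (((size s)%:R * (e / 2) ^+ n)%:E * V)%E.
Proof.
move=> e0; have e20 : 0 < e / 2 by rewrite divr_gt0.
elim: s => [_|x s IH /=]; first by rewrite big_nil measure0 mul0r mul0e.
move=> /andP[/allP xs /IH[ms ls]]; rewrite big_cons; split.
  by apply: measurableU => //; exact: measurable_norm_ball.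
rewrite measureU//; last 2 first.
- exact: measurable_norm_ball.
- apply/seteqP; split => // z [zx]; rewrite -bigcup_seq => -[y /= ys zy].
  have := xs _ ys; rewrite ltNge => /negP; apply.
  rewrite (_ : x - y = (z - y) - (z - x)); last by rewrite opprB [RHS]addrC subrKA.
  apply: le_trans (nmD _ _) _; rewrite nmN.
  by move: zx zy; rewrite /norm_ball/=; lra.
transitivity (((e / 2) ^+ n)%:E * V + ((size s)%:R * (e / 2) ^+ n)%:E * V)%E.
  by congr (_ + _)%E; [exact: lebesgue_norm_ball|exact: ls].
rewrite -ge0_muleDl ?lee_fin; last 2 first.
- by rewrite exprn_ge0// ltW.
- by rewrite mulr_ge0// exprn_ge0// ltW.
by congr (_ * _)%E; rewrite -EFinD -[(size s).+1]add1n natrD mulrDl mul1r.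
Qed.

(** The disjoint balls of radius [e / 2] around the points lie in the ball of radius [1 + e / 2];
    the unit volume, positive and finite, cancels. *)
Lemma separated_size (e : R) (s : seq 'rV[R]_n) : 0 < e ->
  (forall x, x \in s -> nm x <= 1) ->
  pairwise (fun x y => e < nm (x - y)) s -> (size s)%:R <= (1 + 2 / e) ^+ n.
Proof.
move=> e0 s1 se; have e20 : 0 < e / 2 by rewrite divr_gt0.
have [ms ls] := lebesgue_separated e0 se.
have : (lebesgue_rV n (\big[setU/set0]_(x <- s) norm_ball x (e / 2)) <=
    lebesgue_rV n (norm_ball 0 (1 + e / 2)%R))%E.
  apply: le_measure; rewrite ?inE//; first exact: measurable_norm_ball.
  move=> z; rewrite -bigcup_seq => -[y /= ys]; rewrite /norm_ball/= subr0 => zy.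
  rewrite -[z](subrK y); apply: le_lt_trans (nmD _ _) _.
  by have := s1 _ ys; lra.
rewrite ls lebesgue_norm_ball; last by lra.
have Vfin : V \is a fin_num.
  by rewrite ge0_fin_numE ?lebesgue_unit_ball_lty//; exact: measure_ge0.
have V0 : 0 < fine V.
  by rewrite fine_gt0// lebesgue_unit_ball_gt0 lebesgue_unit_ball_lty.
rewrite -(fineK Vfin) -!EFinM lee_fin ler_pM2r// -ler_pdivlMr ?exprn_gt0//.
rewrite -expr_div_n (_ : (1 + e / 2) / (e / 2) = 1 + 2 / e)//.
by field; rewrite gt_eqF.
Qed.

(** A separated family of maximal size is a net, and the volume bound ensures that a maximal size
    exists. Its points belong to [S], which matters when [S] is the unit sphere. *)
Lemma net_exists (e : R) (S : set 'rV[R]_n) : 0 < e ->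
  (forall x, S x -> nm x <= 1) ->
  exists s : seq 'rV[R]_n, [/\ forall x, x \in s -> S x,
    (size s)%:R <= (1 + 2 / e) ^+ n &
    forall x, S x -> exists2 y, y \in s & nm (x - y) <= e].
Proof.
move=> e0 S1.
pose sep k := `[< exists s : seq 'rV[R]_n, [/\ size s = k,
  forall x, x \in s -> S x & pairwise (fun x y => e < nm (x - y)) s] >].
have exsep : exists k, sep k by exists 0%N; apply/asboolP; exists [::].
have ub k : sep k -> (k <= Num.truncn ((1 + 2 / e) ^+ n))%N.
  move=> /asboolP[s [<- sS se]].
  have sz := @separated_size e s e0 (fun x xs => S1 _ (sS _ xs)) se.
  by rewrite -ltnS -(ltr_nat R); apply: le_lt_trans sz (truncnS_gt _).
case: (ex_maxnP exsep ub) => k /asboolP[s [sk sS se]] kmax.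
exists s; split => //; first exact: separated_size (fun x xs => S1 _ (sS _ xs)) se.
move=> x Sx; apply: contrapT => nx.
have /kmax : sep (size s).+1.
  apply/asboolP; exists (x :: s); split => //=.
    by move=> y; rewrite inE => /predU1P[->//|]; exact: sS.
  rewrite se andbT; apply/allP => y ys; rewrite ltNge; apply/negP => xy.
  by apply: nx; exists y.
by rewrite sk ltnn.
Qed.

(* A seminorm controlled on a 1/2-net is controlled on the unit ball: peel off
   the nearest net point and rescale the remainder, j times. *)
Lemma half_net_seminorm (phi : 'rV[R]_n -> R) (s : seq 'rV[R]_n) (Q L : R) :
  (forall x y, phi (x + y) <= phi x + phi y) ->
  (forall c x, 0 <= c -> phi (c *: x) = c * phi x) ->
  (forall x, phi x <= L * `|x|) ->
  (forall x, nm x <= 1 -> exists2 y, y \in s & nm (x - y) <= 2^-1) ->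
  (forall y, y \in s -> phi y <= Q) ->
  forall x, nm x <= 1 -> phi x <= 2 * Q.
Proof.
move=> phiD phiZ phiL net phis.
(* Any a priori bound will do: its contribution is halved at every step of the induction. *)
have L0 x : nm x <= 1 -> phi x <= `|L| / m.
  move=> x1; apply: le_trans (phiL x) _.
  apply: (@le_trans _ _ (`|L| * `|x|)); first by rewrite ler_wpM2r// ler_norm.
  rewrite ler_wpM2l// -[leRHS]mul1r ler_pdivlMr// mulrC.
  exact: le_trans (nm_ge x) x1.
have step j : forall x, nm x <= 1 -> phi x <= 2 * Q + 2^-1 ^+ j * (`|L| / m + 2 * `|Q|).
  elim: j => [|j IH] x x1.
    apply: le_trans (L0 x x1) _; rewrite expr0 mul1r.
    by have := ler_norm (- Q); rewrite normrN; lra.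
  have [y ys xy] := net x x1.
  have -> : x = y + 2^-1 *: (2 *: (x - y)).
    by rewrite scalerA mulVf// scale1r addrC subrK.
  apply: le_trans (phiD _ _) _; rewrite phiZ ?invr_ge0//.
  have : phi (2 *: (x - y)) <= 2 * Q + 2^-1 ^+ j * (`|L| / m + 2 * `|Q|).
    apply: IH; rewrite nmZ ger0_norm//; lra.
  rewrite exprS; have := phis y ys; lra.
move=> x x1; apply/ler_addgt0Pr => e e0.
have W0 : 0 <= `|L| / m + 2 * `|Q| by rewrite addr_ge0 ?mulr_ge0// invr_ge0 ltW.
set W := `|L| / m + 2 * `|Q| in W0 step.
pose j := (Num.truncn (W / e)).+1.
apply: le_trans (step j x x1) _; rewrite lerD2l exprVn ler_pdivrMl ?exprn_gt0//.
rewrite -ler_pdivrMr//; apply: le_trans (ltW (truncnS_gt _)) _.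
by rewrite -/j -natrX ler_nat; exact/ltnW/ltn_expl.
Qed.

End nets.

(** * Separation from an absolutely convex hull *)

Lemma dotv_sub_sq (R : realType) n (u v : 'rV[R]_n) (l : R) :
  dotv (u - l *: v) (u - l *: v) =
  dotv u u - 2 * l * dotv v u + l ^+ 2 * dotv v v.
Proof.
rewrite -scaleNr !dotvDl !dotvDr !dotvZl !dotvZr (dotvC u v); ring.
Qed.

Section separation.
Context {R : realType} {n : nat}.

Lemma convex_setP (C : set 'rV[R]_n) : convex_set C ->
  forall x y l, 0 <= l <= 1 -> C x -> C y -> C (l *: x + (1 - l) *: y).
Proof.
move=> cC x y l /andP[l0 l1] Cx Cy.
by have := cC x y (Itv01 l0 l1); rewrite !inE => /(_ Cx Cy).
Qed.

(** The missing weight is put on 0. The induction keeps each partial sum in the form total weight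
    times a point of [C], which postpones the normalisation to the end. *)
Lemma convex_set_comb (I : finType) (C : set 'rV[R]_n) (a : I -> R)
    (y : I -> 'rV[R]_n) : convex_set C -> C 0 -> (forall i, 0 <= a i) ->
  (forall i, C (y i)) -> \sum_i a i <= 1 -> C (\sum_i a i *: y i).
Proof.
move=> cC C0 a0 Cy a1.
suff [T0 [v Cv ->]] : 0 <= \sum_i a i /\
    exists2 v, C v & \sum_i a i *: y i = (\sum_i a i) *: v.
  have := @convex_setP C cC v 0 (\sum_i a i); rewrite scaler0 addr0; apply => //.
  by rewrite T0.
elim/big_rec2 : _ => [|i u T _ [T0 [v Cv ->]]].
  by split => //; exists 0; rewrite ?scale0r.
split; first by rewrite addr_ge0.
have [aT|aT] := eqVneq (a i + T) 0.
  have ai : a i = 0 by have := a0 i; lra.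
  have T00 : T = 0 by have := a0 i; lra.
  by exists 0; rewrite // ai T00 !scale0r scaler0 addr0.
have aT0 : 0 < a i + T by rewrite lt_def aT addr_ge0.
exists ((a i / (a i + T)) *: y i + (1 - a i / (a i + T)) *: v).
  apply: convex_setP => //; rewrite divr_ge0 ?addr_ge0//=.
  by rewrite ler_pdivrMr// mul1r lerDl.
rewrite scalerDr !scalerA; congr (_ *: _ + _ *: _).
  by field; rewrite gt_eqF.
by field; rewrite gt_eqF.
Qed.

Variables (N : nat) (x : 'I_N -> 'rV[R]_n).

Let comb (a : 'rV[R]_N) := \sum_i a ord0 i *: x i.

(** Signs of the coefficients are absorbed into the points; 0 is the midpoint of [x 0] and its
    opposite, hence [0 < N]. *)
Lemma comb_absconv (a : 'rV[R]_N) : (0 < N)%N -> \sum_i `|a ord0 i| <= 1 ->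
  absconv x (comb a).
Proof.
move=> N0 a1 C [cC xC].
have C0 : C 0.
  have Cx : C (x (Ordinal N0)) by apply: xC; exists (Ordinal N0); left.
  have CNx : C (- x (Ordinal N0)) by apply: xC; exists (Ordinal N0); right.
  have := @convex_setP C cC _ _ 2^-1 _ Cx CNx.
  rewrite (_ : 1 - 2^-1 = 2^-1); last by field.
  by rewrite scalerN subrr; apply; lra.
rewrite /comb (eq_bigr (fun i => `|a ord0 i| *: (Num.sg (a ord0 i) *: x i))).
  apply: convex_set_comb => // i; case: (sgrP (a ord0 i)) => _.
  - by rewrite scale0r.
  - by rewrite scale1r; apply: xC; exists i; left.
  - by rewrite scaleN1r; apply: xC; exists i; right.
by move=> i _; rewrite scalerA mulrC -numEsg.
Qed.

Lemma continuous_sumr (T : topologicalType) (I : finType) (f : I -> T -> R) :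
  (forall i, continuous (f i)) -> continuous (fun a => \sum_i f i a).
Proof.
by move=> cf; apply: continuous_big => //; exact: add_continuous.
Qed.

Let dist2 (z : 'rV[R]_n) (a : 'rV[R]_N) := dotv (z - comb a) (z - comb a).

Lemma continuous_dist2 z : continuous (dist2 z).
Proof.
have cc j : continuous (fun a => (z - comb a) ord0 j).
  have -> : (fun a => (z - comb a) ord0 j) =
      (fun a : 'rV[R]_N => z ord0 j - \sum_i a ord0 i * x i ord0 j).
    apply/funext => a; rewrite !mxE summxE; congr (_ - _).
    by apply: eq_bigr => i _; rewrite mxE.
  have c1 : continuous (fun _ : 'rV[R]_N => z ord0 j) by exact: cst_continuous.
  have c2 : continuous (fun a : 'rV[R]_N => \sum_i a ord0 i * x i ord0 j).
    apply: continuous_sumr => i b.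
    apply: (@continuous_comp _ _ _ (fun a : 'rV[R]_N => a ord0 i)
      ( *%R^~ (x i ord0 j))); first exact: coord_continuous.
    exact: mulrr_continuous.
  by move=> a; exact: (continuousB (c1 a) (c2 a)).
by apply: continuous_sumr => j a; exact: (continuousM (cc j a) (cc j a)).
Qed.

(** Projection of [z] on the hull, minimising over coefficients in the l1 ball, where compactness is
    immediate. If the residual [t] is nonzero, the first-order condition bounds every
    [|dotv (x i) t|] by [dotv (comb a) t], which is less than [dotv z t]. *)
Lemma absconv_separation z : (0 < N)%N ->
  (forall t, exists i, dotv z t <= `|dotv (x i) t|) -> absconv x z.
Proof.
move=> N0 zx.
pose K := [set a : 'rV[R]_N | \sum_i `|a ord0 i| <= 1].
have K0 : K !=set0.
  by exists 0; rewrite /K/= big1// => i _; rewrite mxE normr0.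
have cK : compact K.
  apply: bounded_closed_compact.
    exists 1; split => // M M1 a /= Ka; apply: ler_norm_coord; first lra.
    move=> i; apply: le_trans (ltW M1); apply: le_trans Ka.
    by rewrite (bigD1 i)//= lerDl sumr_ge0.
  apply: (@closed_comp _ _ (fun a : 'rV[R]_N => \sum_i `|a ord0 i|)
    [set y | y <= 1]); last exact: closed_le.
  move=> a _; apply: continuous_sumr => i {}a.
  apply: (@continuous_comp _ _ _ (fun a : 'rV[R]_N => a ord0 i) Num.norm).
    exact: coord_continuous.
  exact: norm_continuous.
have [a /[!inE] Ka amin] := EVT_min_rV K0 cK
  (continuous_subspaceT (@continuous_dist2 z)).
pose t := z - comb a.
have [t0|t0] := eqVneq (dotv t t) 0.
  suff -> : z = comb a by exact: comb_absconv.
  apply/eqP; rewrite -subr_eq0 -/t; apply/eqP/rowP => j; rewrite [RHS]mxE.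
  apply/eqP; rewrite -sqrf_eq0 expr2; apply/eqP.
  move/eqP: t0; rewrite /dotv psumr_eq0; last by move=> i _; rewrite -expr2 sqr_ge0.
  by move=> /allP/(_ j); rewrite mem_index_enum => /(_ isT)/eqP.
have tt0 : 0 < dotv t t.
  by rewrite lt_def t0/= sumr_ge0// => i _; rewrite -expr2 sqr_ge0.
have var (b : 'rV[R]_N) : K b -> dotv (comb b - comb a) t <= 0.
  move=> Kb; set v := comb b - comb a.
  rewrite leNgt; apply/negP => v0.
  have vv0 : 0 <= dotv v v by rewrite sumr_ge0// => i _; rewrite -expr2 sqr_ge0.
  have H (l : R) : 0 <= l <= 1 -> 2 * l * dotv v t <= l ^+ 2 * dotv v v.
    move=> l01; have Kl : K ((1 - l) *: a + l *: b).
      rewrite /K/=; apply: (@le_trans _ _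
          (\sum_i ((1 - l) * `|a ord0 i| + l * `|b ord0 i|))).
        apply: ler_sum => i _; rewrite !mxE; apply: le_trans (ler_normD _ _) _.
        rewrite !normrM [`|1 - l|]ger0_norm; last by lra.
        by rewrite [`|l|]ger0_norm; last by lra.
      rewrite big_split/= -!mulr_sumr; move: Ka Kb; rewrite /K/=; nra.
    have := amin ((1 - l) *: a + l *: b); rewrite inE => /(_ Kl).
    rewrite /dist2.
    have -> : comb ((1 - l) *: a + l *: b) = comb a + l *: v.
      have -> : comb ((1 - l) *: a + l *: b) = (1 - l) *: comb a + l *: comb b.
        rewrite /comb !scaler_sumr -big_split/=; apply: eq_bigr => i _.
        by rewrite !mxE !scalerA -scalerDl.
      by rewrite /v scalerBl scale1r scalerBr -addrA [- _ + _]addrC.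
    by rewrite opprD addrA -/t dotv_sub_sq; lra.
  (* The squared distance is a quadratic in [l]; it is tested at its minimiser
     [dotv v t / dotv v v], capped at 1. *)
  have [vv|vv] := leP (dotv v v) (dotv v t).
    have := H 1; rewrite expr1n !mulr1 mul1r lexx ler01 => /(_ isT); lra.
  have vvp : 0 < dotv v v by exact: lt_trans vv.
  have := H (dotv v t / dotv v v).
  rewrite divr_ge0 ?(ltW v0)//= ler_pdivrMr// mul1r (ltW vv) => /(_ isT).
  have -> : (dotv v t / dotv v v) ^+ 2 * dotv v v = dotv v t / dotv v v * dotv v t.
    by field; rewrite gt_eqF.
  have : 0 < dotv v t / dotv v v * dotv v t by rewrite !mulr_gt0 ?invr_gt0.
  lra.
have ext i (s : R) : `|s| <= 1 -> s * dotv (x i) t <= dotv (comb a) t.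
  move=> s1; have := var (s *: delta_mx ord0 i).
  have -> : comb (s *: delta_mx ord0 i) = s *: x i.
    rewrite /comb (bigD1 i)//= !mxE !eqxx mulr1 big1 ?addr0// => j ji.
    by rewrite !mxE (negbTE ji) andbF mulr0 scale0r.
  rewrite -scaleN1r dotvDl !dotvZl => h.
  suff /h : K (s *: delta_mx ord0 i) by lra.
  rewrite /K/= (bigD1 i)//= !mxE !eqxx mulr1 big1 ?addr0// => j ji.
  by rewrite !mxE (negbTE ji) andbF mulr0 normr0.
have [i zi] := zx t.
have : `|dotv (x i) t| <= dotv (comb a) t.
  apply/ler_normlP; split.
  - by have := ext i (-1); rewrite normrN1 mulN1r; apply.
  - by have := ext i 1; rewrite normr1 mul1r; apply.
have : dotv z t = dotv t t + dotv (comb a) t by rewrite -dotvDl /t subrK.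
by lra.
Qed.

End separation.

(** * The random polytope *)

Section centroid_norm.
Context {R : realType} {n : nat} {d : measure_display} {Omega : measurableType d}.
Context {P : probability Omega R} (X : {RV P >-> 'rV[R]_n}).
Hypotheses (sX : symmetric_rvec P X) (lX : log_concave P X).
Variable p : R.
Hypothesis p1 : 1 <= p.

Let p0 : 0 < p. Proof. exact: lt_le_trans p1. Qed.

Definition Lp_nm (t : 'rV[R]_n) : R := fine (Lp_norm X p t).

Lemma Lp_nmE t : (Lp_nm t)%:E = Lp_norm X p t.
Proof.
rewrite fineK// ge0_fin_numE; first exact: Lp_norm_lty.
exact: Lnorm_ge0.
Qed.

Lemma Lp_nm_ge0 t : 0 <= Lp_nm t.
Proof. by rewrite fine_ge0//; exact: Lnorm_ge0. Qed.

Let mdot t : measurable_fun [set: Omega] (fun w => dotv (X w) t).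
Proof. by apply: (measurableT_comp (measurable_dotv t)); exact: measurable_funP. Qed.

Lemma Lp_nmD s t : Lp_nm (s + t) <= Lp_nm s + Lp_nm t.
Proof.
rewrite -lee_fin EFinD !Lp_nmE.
have := @minkowski_EFin _ _ _ P _ _ p (mdot s) (mdot t) p1.
apply: le_trans; rewrite le_eqVlt; apply/orP; left; apply/eqP.
by apply: eq_Lnorm => w /=; rewrite dotvDr.
Qed.

(** Integration gives one inequality for every scalar; applied to [c^-1] it gives the converse. *)
Lemma Lp_nmZ c t : Lp_nm (c *: t) = `|c| * Lp_nm t.
Proof.
have le (b : R) s : Lp_nm (b *: s) <= `|b| * Lp_nm s.
  rewrite -lee_fin Lp_nmE; apply/Lnorm_leP => //.
    by rewrite mulr_ge0// Lp_nm_ge0.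
  have := (@Lnorm_leP _ _ _ P (fun w => dotv (X w) s) p (Lp_nm s) p0 (Lp_nm_ge0 _)).1.
  rewrite -[X in (X <= _)%E]/(Lp_norm X p s) Lp_nmE => /(_ (lexx _)) h.
  rewrite powRM ?Lp_nm_ge0//.
  apply: (@le_trans _ _ ((`|b| `^ p)%:E * \int[P]_w (`|dotv (X w) s| `^ p)%:E)%E).
    have mF : measurable_fun [set: Omega] (fun w => (`|dotv (X w) s| `^ p)%:E).
      apply/measurable_EFinP.
      apply: (@measurableT_comp _ _ _ _ _ _ (fun x : R => x `^ p)) => //.
      by apply: measurableT_comp => //; exact: mdot.
    rewrite -ge0_integralZl//.
    rewrite le_eqVlt; apply/orP; left; apply/eqP; apply: eq_integral => w _.
    by rewrite dotvZr normrM powRM.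
  by rewrite EFinM lee_wpmul2l// lee_fin powR_ge0.
have [->|c0] := eqVneq c 0.
  apply/eqP; rewrite eq_le le normr0 mul0r/=.
  exact: Lp_nm_ge0.
apply/eqP; rewrite eq_le le/=.
rewrite -ler_pdivlMl ?normr_gt0// -normfV.
by apply: le_trans (le _ _); rewrite scalerA mulVf// scale1r.
Qed.

Lemma Lp_nm_sum (I : finType) (F : I -> 'rV[R]_n) :
  Lp_nm (\sum_i F i) <= \sum_i Lp_nm (F i).
Proof.
elim/big_rec2 : _ => [|i y x _ xy]; last first.
  by apply: le_trans (Lp_nmD _ _) _; rewrite lerD2l.
by rewrite -(scale0r 0) Lp_nmZ normr0 mul0r.
Qed.

Let Lp_upper : R := 1 + \sum_(i < n) Lp_nm (delta_mx ord0 i).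

Let Lp_upper_gt0 : 0 < Lp_upper.
Proof. by rewrite ltr_wpDr// sumr_ge0// => i _; exact: Lp_nm_ge0. Qed.

Let Lp_nm_upper x : Lp_nm x <= Lp_upper * `|x|.
Proof.
rewrite {1}[x]row_sum_delta; apply: le_trans (Lp_nm_sum _) _.
rewrite /Lp_upper mulrDl mul1r ler_wpDl// mulr_suml; apply: ler_sum => i _.
by rewrite Lp_nmZ mulrC ler_wpM2l ?Lp_nm_ge0// ler_coord_norm.
Qed.

Lemma continuous_Lp_nm : continuous Lp_nm.
Proof.
have lip x y : Lp_nm x - Lp_nm y <= Lp_upper * `|x - y|.
  apply: le_trans (Lp_nm_upper (x - y)).
  by rewrite lerBlDr -{1}[x](subrK y) Lp_nmD.
move=> x A /nbhs_ballP[e /= e0 eA]; apply/nbhs_ballP.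
exists (e / Lp_upper) => /=; first by rewrite divr_gt0.
move=> y; rewrite mx_norm_ball /ball_/= ltr_pdivlMr// mulrC => xy.
apply: eA; rewrite /ball/= ltr_norml; apply/andP; split.
  by have := lip y x; rewrite distrC; lra.
by have := lip x y; lra.
Qed.

Lemma continuous_dotv (t : 'rV[R]_n) : continuous (fun x => dotv x t).
Proof.
apply: continuous_sumr => i b.
apply: (@continuous_comp _ _ _ (fun a : 'rV[R]_n => a ord0 i)
  ( *%R^~ (t ord0 i))); first exact: coord_continuous.
exact: mulrr_continuous.
Qed.

Hypothesis ndX : nondegenerate_rvec P X.

(** If the norm vanishes, [dotv (X w) t] is almost surely zero. The open set where [dotv y t] is
    nonzero is then null, which confines the support to the orthogonal of [t], a proper subspace. *)
Lemma Lp_nm_gt0 t : t != 0 -> 0 < Lp_nm t.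
Proof.
move=> t0; rewrite lt_def Lp_nm_ge0 andbT; apply/eqP => nt.
have tt : dotv t t != 0.
  apply: contra t0; rewrite /dotv psumr_eq0; last by move=> i _; rewrite -expr2 sqr_ge0.
  move=> /allP t2; apply/eqP/rowP => i; rewrite mxE.
  have := t2 i; rewrite mem_index_enum => /(_ isT).
  by rewrite -expr2 sqrf_eq0 => /eqP.
have dotmx x : (x *m t^T) ord0 ord0 = dotv x t.
  by rewrite mxE; apply: eq_bigr => i _; rewrite mxE.
have memV x : (x \in lker (linfun (mulmxr t^T))) = (dotv x t == 0).
  rewrite memv_ker lfunE/= -dotmx; apply/eqP/eqP => [->|h]; first by rewrite mxE.
  by apply/matrixP => i j; rewrite !ord1 h mxE.
apply: (ndX (V := lker (linfun (mulmxr t^T)))).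
  apply: contra tt => /eqP V; rewrite -memV V; exact: memvf.
move=> x xS; rewrite /= memV; apply/negPn/negP => xt.
pose U := [set y : 'rV[R]_n | 0 < `|dotv y t|].
have oU : open U.
  apply: (@open_comp _ _ (fun y : 'rV[R]_n => `|dotv y t|) [set z | 0 < z]).
    move=> y _; apply: (@continuous_comp _ _ _ (fun a => dotv a t) Num.norm).
      exact: continuous_dotv.
    exact: norm_continuous.
  exact: open_gt.
have := xS U oU; rewrite /U/= normr_gt0 => /(_ xt).
suff -> : P (X @^-1` U) = 0%E by rewrite ltxx.
have := Lp_nmE t; rewrite nt => /esym.
have mEdot : measurable_fun [set: Omega] (fun w => (dotv (X w) t)%:E).
  by apply/measurable_EFinP; exact: mdot.
have pE : (0 < p%:E)%E by rewrite lte_fin.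
move=> /(Lnorm_eq0_eq0 mEdot pE).
move=> -[A [mA PA sA]].
apply/eqP; rewrite eq_le measure_ge0 andbT -PA.
apply: le_measure; rewrite ?inE//.
  by apply: measurable_preimage_RV; exact: open_measurable_rV.
move=> w /=; rewrite /U/= normr_gt0 => /eqP wt; apply: sA => /= h.
by apply: wt; have /eqP := h I; rewrite eqe => /eqP.
Qed.

(** The lower constant is the minimum of the continuous [Lp_nm] on the compact unit sphere of the
    sup norm, nonempty since [0 < n]. *)
Lemma Lp_nm_bounds : (0 < n)%N -> exists m M, [/\ 0 < m, 0 < M,
  forall x, m * `|x| <= Lp_nm x & forall x, Lp_nm x <= M * `|x|].
Proof.
move=> n0; pose K := [set x : 'rV[R]_n | `|x| = 1].
have K0 : K !=set0.
  pose x : 'rV[R]_n := const_mx 1.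
  have x0 : `|x| != 0.
    rewrite normr_eq0; apply/eqP => /rowP/(_ (Ordinal n0)); rewrite !mxE.
    exact/eqP/oner_neq0.
  by exists (`|x|^-1 *: x); rewrite /K/= normrZ normfV normr_id mulVf.
have cK : compact K.
  apply: bounded_closed_compact.
    by exists 1; split => // M M1 x /= ->; exact: ltW.
  apply: (@closed_comp _ _ (Num.norm : 'rV[R]_n -> R) [set y | y = 1]).
    by move=> y _; exact: norm_continuous.
  exact: closed_eq.
have [a /[!inE] Ka amin] := EVT_min_rV K0 cK
  (continuous_subspaceT continuous_Lp_nm).
have a0 : a != 0 by rewrite -normr_eq0 Ka oner_neq0.
exists (Lp_nm a), Lp_upper; split => //; first exact: Lp_nm_gt0.
move=> x; have [->|x0] := eqVneq x 0; first by rewrite normr0 mulr0 Lp_nm_ge0.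
have xp : 0 < `|x| by rewrite normr_gt0.
have := amin (`|x|^-1 *: x); rewrite inE => /(_ _)/wrap[].
  by rewrite /K/= normrZ normfV normr_id mulVf// gt_eqF.
by rewrite Lp_nmZ normfV normr_id ler_pdivlMl// mulrC.
Qed.

End centroid_norm.

Lemma union_bound (R : realType) d (Omega : measurableType d)
    (P : probability Omega R) (T : eqType) (s : seq T) (b : R)
    (Q : T -> Omega -> Prop) :
  (forall y, y \in s -> exists B : set Omega, [/\ measurable B, (P B <= b%:E)%E &
    forall x, ~ B x -> Q y x]) ->
  exists B : set Omega, [/\ measurable B, (P B <= ((size s)%:R * b)%:E)%E &
    forall x, ~ B x -> forall y, y \in s -> Q y x].
Proof.
elim: s => [_|y s IH H].
  by exists set0; split; rewrite ?measure0 ?mul0r.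
have [|B [mB PB QB]] := IH; first by move=> z zs; apply: H; rewrite inE zs orbT.
have [|C [mC PC QC]] := H y; first by rewrite mem_head.
exists (B `|` C); split; first exact: measurableU.
  apply: le_trans (measureU2 _ _ _) _ => //.
  by rewrite /= -addn1 natrD mulrDl mul1r EFinD leeD.
move=> x /not_orP[nB nC] z; rewrite inE => /predU1P[->|]; first exact: QC.
exact: QB.
Qed.

(** * Bounds holding for all directions simultaneously *)

Section uniform.
Context {R : realType} {n N : nat} {d : measure_display}.
Context {Omega : measurableType d} {P : probability Omega R}.
Variable X : {RV P >-> 'rV[R]_n}.
Hypotheses (sX : symmetric_rvec P X) (lX : log_concave P X).
Hypothesis ndX : nondegenerate_rvec P X.
Variable p : R.
Hypothesis p1 : 1 <= p.
Hypothesis n0 : (0 < n)%N.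
Variable Xs : 'I_N -> {RV P >-> 'rV[R]_n}.
Hypothesis idX : forall i, identically_distributed P (Xs i) X.
Hypothesis indep : mutually_independent P (fun i => Xs i : Omega -> 'rV[R]_n).

Local Notation nm := (Lp_nm X p).
Let delta : R := expR (- (p / 2)).
Let delta0 : 0 < delta. Proof. exact: expR_gt0. Qed.

Let tailE i t a : P (Xs i @^-1` [set x | a <= `|dotv x t|]) = tail X t a.
Proof. by rewrite idX//; exact: measurable_normr_dotv_ge. Qed.

(** Here [5 = 1 + 2 / (1/2)] counts the 1/2-net, and [192 = 2 * 96] is the loss in passing from the
    net to the ball. *)
Lemma uniform_sum_bounded : exists B : set Omega, [/\ measurable B,
  (P B <= (5 ^+ n * expR (- (3 * N%:R)))%:E)%E &
  forall w, ~ B w -> forall e v, 0 < e -> nm v <= e ->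
    \sum_(i < N) `|dotv (Xs i w) v| <= e * (192 * N%:R)].
Proof.
have [m [M [m0 M0 nm_ge nm_le]]] := Lp_nm_bounds sX lX p1 ndX n0.
have nmZ := Lp_nmZ sX lX p1; have nmD := Lp_nmD sX lX p1.
have e2 : 0 < 2^-1 :> R by rewrite invr_gt0.
have [s [s1 ssize net]] :=
  net_exists nmD nmZ m0 M0 nm_ge nm_le (S := [set t | nm t <= 1]) e2 (fun _ h => h).
have [|B [mB PB QB]] := @union_bound _ _ _ P _ s (expR (- (3 * N%:R)))
    (fun y w => \sum_(i < N) `|dotv (Xs i w) y| <= 96 * N%:R).
  move=> y /s1 y1; apply: sum_bounded => // i k; rewrite tailE.
  by apply: (tail_le_exp sX lX p1); rewrite -Lp_nmE// lee_fin.
exists B; split => //.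
  apply: le_trans PB _; rewrite lee_fin ler_wpM2r ?expR_ge0//.
  by apply: le_trans ssize _; rewrite invrK (_ : 1 + 2 * 2 = 5)//; ring.
move=> w nB e v e0 ve.
have := @half_net_seminorm _ _ _ nmZ m m0 nm_ge
  (fun v => \sum_(i < N) `|dotv (Xs i w) v|) s (96 * N%:R)
  (\sum_(i < N) \sum_(j < n) `|Xs i w ord0 j|) _ _ _ net (QB w nB) (e^-1 *: v).
move=> /(_ _ _ _ _)/wrap[].
- move=> x y; rewrite -big_split/=; apply: ler_sum => i _.
  by rewrite dotvDr ler_normD.
- move=> c x c0; rewrite mulr_sumr; apply: eq_bigr => i _.
  by rewrite dotvZr normrM (ger0_norm c0).
- move=> x; rewrite mulr_suml; apply: ler_sum => i _.
  apply: le_trans (ler_norm_sum _ _ _) _; rewrite mulr_suml.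
  by apply: ler_sum => j _; rewrite normrM ler_wpM2l// ler_coord_norm.
- by rewrite nmZ gtr0_norm ?invr_gt0// ler_pdivrMl// mulr1.
have -> : \sum_(i < N) `|dotv (Xs i w) (e^-1 *: v)| =
    e^-1 * \sum_(i < N) `|dotv (Xs i w) v|.
  rewrite mulr_sumr; apply: eq_bigr => i _.
  by rewrite dotvZr normrM gtr0_norm// invr_gt0.
rewrite ler_pdivrMl// => h; apply: le_trans h _.
by rewrite ler_pM2l//; lra.
Qed.

(** The net is taken inside the unit sphere of [nm], where [tail_ge_small_ball] applies. *)
Lemma uniform_many_large (e : R) : 0 < e -> exists B : set Omega,
  [/\ measurable B,
  (P B <= ((1 + 2 / e) ^+ n * expR (- (delta * N%:R / 4)))%:E)%E &
  forall w, ~ B w -> forall t, nm t = 1 -> exists2 y, nm (t - y) <= e &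
    delta * N%:R / 4 < \sum_(i < N) (`[< 192^-1 <= `|dotv (Xs i w) y| >] : nat)%:R].
Proof.
move=> e0.
have [m [M [m0 M0 nm_ge nm_le]]] := Lp_nm_bounds sX lX p1 ndX n0.
have nmZ := Lp_nmZ sX lX p1; have nmD := Lp_nmD sX lX p1.
have [|s [s1 ssize net]] :=
  net_exists nmD nmZ m0 M0 nm_ge nm_le (S := [set t | nm t = 1]) e0.
  by move=> x /= ->.
have [|B [mB PB QB]] := @union_bound _ _ _ P _ s (expR (- (delta * N%:R / 4)))
    (fun y w => delta * N%:R / 4 <
      \sum_(i < N) (`[< 192^-1 <= `|dotv (Xs i w) y| >] : nat)%:R).
  move=> y /s1 /= y1.
  apply: (@many_large _ _ _ _ _ _ Xs indep [set x | 192^-1 <= `|dotv x y|] delta).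
  - exact: measurable_normr_dotv_ge.
  - move=> i; rewrite tailE; apply: (tail_ge_small_ball sX lX p1).
    by rewrite -Lp_nmE// y1.
  - by move=> i j; rewrite !tailE.
exists B; split => //.
  by apply: le_trans PB _; rewrite lee_fin ler_wpM2r ?expR_ge0.
move=> w nB t t1; have [y ys ty] := net t t1.
by exists y => //; exact: QB.
Qed.

Lemma uniform_large_deviation : exists B : set Omega, [/\ measurable B,
  (P B <= (5 ^+ n * expR (- (3 * N%:R)) +
     (1 + 768 * 768 / delta) ^+ n * expR (- (delta * N%:R / 4)))%:E)%E &
  forall w, ~ B w -> forall t, nm t = 1 ->
    exists i, 384^-1 <= `|dotv (Xs i w) t|].
Proof.
(* Chosen so that [e * 192 N], the bound on the total perturbation, equals [delta N / 4] times
   [384^-1]. *)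
pose e := delta / (384 * 768).
have e0 : 0 < e by apply: divr_gt0; [exact: delta0|apply: mulr_gt0; rewrite ltr0n].
have [B [mB PB QB]] := uniform_sum_bounded.
have [C [mC PC QC]] := uniform_many_large e0.
exists (B `|` C); split; first exact: measurableU.
  apply: le_trans (measureU2 _ _ _) _ => //; rewrite EFinD leeD//.
  apply: le_trans PC _; rewrite lee_fin.
  rewrite (_ : 2 / e = 768 * 768 / delta)// /e; field.
  by rewrite gt_eqF.
move=> w /not_orP[nB nC] t t1; have [y ty large] := QC w nC t t1.
apply: contrapT => nex.
have small i : `|dotv (Xs i w) t| < 384^-1.
  by rewrite ltNge; apply/negP => h; apply: nex; exists i.
(* If all copies are below [384^-1] at [t], each copy reaching [192^-1] at [y] contributes at least
   [384^-1] to the sum at [t - y]; there are too many of them for that sum. *)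
have := QB w nB e (t - y) e0 ty.
rewrite leNgt => /negP; apply.
apply: (@lt_le_trans _ _ (384^-1 *
    \sum_(i < N) (`[< 192^-1 <= `|dotv (Xs i w) y| >] : nat)%:R)).
  rewrite (_ : e * (192 * N%:R) = 384^-1 * (delta * N%:R / 4)); last first.
    by rewrite /e; field.
  by rewrite ltr_pM2l// invr_gt0.
rewrite mulr_sumr; apply: ler_sum => i _; case: asboolP => yi; last by rewrite mulr0.
rewrite mulr1; have := small i.
have : `|dotv (Xs i w) y| <= `|dotv (Xs i w) t| + `|dotv (Xs i w) (t - y)|.
  have -> : dotv (Xs i w) y = dotv (Xs i w) t - dotv (Xs i w) (t - y).
    by rewrite dotvDr dotvNr; ring.
  exact: ler_normB.
by lra.
Qed.

(** For [z] in the polar body, [dotv z t <= nm t] by homogeneity, so the lower bound on the unit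
    sphere gives the support-function inequality required by the separation lemma. *)
Lemma centroid_body_sub_absconv (c : R) (x : 'I_N -> 'rV[R]_n) :
  0 <= c -> (0 < N)%N ->
  (forall t, nm t = 1 -> exists i, c <= `|dotv (x i) t|) ->
  [set c *: z | z in centroid_body P X p] `<=` absconv x.
Proof.
move=> c0 N0 H _ [z zZ <-]; apply: absconv_separation => // t.
have [->|t0] := eqVneq t 0.
  exists (Ordinal N0); rewrite [dotv _ 0](_ : _ = 0) ?normr_ge0//.
  by rewrite /dotv big1// => i _; rewrite [X in _ * X]mxE mulr0.
have nt : 0 < nm t by exact: Lp_nm_gt0.
have n1 : nm ((nm t)^-1 *: t) = 1.
  by rewrite Lp_nmZ// gtr0_norm ?invr_gt0// mulVf// gt_eqF.
have [i ci] := H _ n1; exists i.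
have zt : dotv ((nm t)^-1 *: t) z <= 1.
  by apply: zZ; rewrite /Lp_ball/= -[X in (X <= _)%E]/(Lp_norm X p _) -Lp_nmE// n1.
rewrite dotvZr normrM gtr0_norm ?invr_gt0// ler_pdivlMl// in ci.
rewrite dotvZl ler_pdivrMl// mulr1 dotvC in zt.
by rewrite dotvZl; apply: le_trans ci; rewrite mulrC ler_wpM2r.
Qed.

End uniform.

(** * Numerical estimates for the failure probability *)

Section numerics.
Context {R : realType}.

Lemma expR2_ge5 : 5 <= expR 2 :> R.
Proof.
have -> : (2 : R) = 4%:R * 2^-1 by field.
rewrite expRM_natl; have h := expR_ge1Dx (2^-1 : R).
apply: (@le_trans _ _ ((1 + 2^-1) ^+ 4)); first by lra.
by rewrite lerXn2r// nnegrE ?expR_ge0//; lra.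
Qed.

(** Here [328 + 8 L] is [16 (20 + (1 + L) / 2)], the cost to be absorbed in [failure_exponent]; 160
    is a round value beyond which [(1 + L/4)^2] exceeds it. *)
Lemma large_expR_half (L : R) : 160 <= L -> 328 + 8 * L <= expR (L / 2).
Proof.
move=> L160; have -> : L / 2 = 2%:R * (L / 4) by field.
rewrite expRM_natl; have h := expR_ge1Dx (L / 4).
apply: (@le_trans _ _ ((1 + L / 4) ^+ 2)); last first.
  by rewrite lerXn2r// nnegrE ?expR_ge0//; lra.
rewrite expr2; nra.
Qed.

(* With N = n e^L, the exponents in the union bound are compared after
   dividing by n. *)
Lemma failure_exponent (alpha L : R) : 0 < alpha < 1 -> 160 <= L ->
  20 + alpha * (1 + L) / 2 + expR ((1 - alpha) * L) / 16 <=
  expR (- (alpha * (1 + L) / 2)) * expR L / 4.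
Proof.
move=> a01 L160; rewrite -expRD.
have -> : - (alpha * (1 + L) / 2) + L = - (alpha / 2) + (1 - alpha / 2) * L by field.
rewrite expRD; set E := expR ((1 - alpha / 2) * L).
(* The right side is at least [E / 8]: one half of it covers the target rate
   [expR ((1 - alpha) * L) / 16], the other half the cost of the net. *)
have E1 : expR (L / 2) <= E by rewrite ler_expR; nra.
have E2 : expR ((1 - alpha) * L) <= E by rewrite ler_expR; nra.
have E3 : 2^-1 <= expR (- (alpha / 2)).
  by apply: le_trans (expR_ge1Dx _); lra.
have := large_expR_half L160; have aL : alpha * (1 + L) <= 1 + L by nra.
have E0 : 0 <= E by exact: expR_ge0.
nra.
Qed.

(** In the lower bound on [N / n], 160 serves [failure_exponent], and [alpha^-1] yields
    [alpha * L >= 1], hence [p >= 1], as Minkowski's inequality requires. *)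
Lemma failure_probability (n N : nat) (alpha : R) : (0 < n)%N -> 0 < alpha < 1 ->
  expR (160 + alpha^-1) * n%:R <= N%:R ->
  let p := alpha * ln (expR 1 * N%:R / n%:R) in
  [/\ (0 < N)%N, 1 <= p &
   5 ^+ n * expR (- (3 * N%:R)) + (1 + 768 * 768 / expR (- (p / 2))) ^+ n *
     expR (- (expR (- (p / 2)) * N%:R / 4)) <=
   2 * expR (- (16^-1 * N%:R `^ (1 - alpha) * n%:R `^ alpha))].
Proof.
move=> n0 a01 nN p.
have K0 : 0 <= 768 * 768 :> R by apply: mulr_ge0; rewrite ler0n.
(* As [2^20 <= exp(20)], the net has at most [exp(n (20 + p/2))] points. *)
have K20 : 1 + 768 * 768 <= 2 ^+ 20 :> R by lra.
move: (768 * 768 : R) K0 K20 => K K0 K20.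
have nR : 0 < n%:R :> R by rewrite ltr0n.
have NR : 0 < N%:R :> R by apply: lt_le_trans nN; rewrite mulr_gt0// expR_gt0.
have N0 : (0 < N)%N by rewrite -(ltr0n R).
pose L : R := ln (N%:R / n%:R).
have LE : expR L = N%:R / n%:R by rewrite lnK// posrE divr_gt0.
have NE : N%:R = n%:R * expR L by rewrite LE mulrC divfK// gt_eqF.
have aV : 0 < alpha^-1 by rewrite invr_gt0; lra.
have L160a : 160 + alpha^-1 <= L by rewrite -ler_expR LE ler_pdivlMr.
have L160 : 160 <= L by lra.
have pE : p = alpha * (1 + L).
  by rewrite /p -mulrA lnM ?posrE ?expR_gt0 ?divr_gt0// expRK.
have p1 : 1 <= p.
  have : alpha * alpha^-1 <= alpha * L by rewrite ler_pM2l; lra.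
  by rewrite mulfV ?pE; [nra|lra].
split => //; set delta := expR (- (p / 2)).
have lnN : ln N%:R = ln n%:R + L :> R.
  by rewrite {1}NE lnM ?posrE ?expR_gt0// expRK.
have powE : N%:R `^ (1 - alpha) * n%:R `^ alpha = n%:R * expR ((1 - alpha) * L) :> R.
  rewrite /powR !gt_eqF// -expRD lnN -[in RHS](lnK (_ : n%:R \is Num.pos)) ?posrE//.
  by rewrite -expRD; congr expR; ring.
have -> : 16^-1 * N%:R `^ (1 - alpha) * n%:R `^ alpha =
    16^-1 * (n%:R * expR ((1 - alpha) * L)) by rewrite -mulrA powE.
(* One copy of the target exponential for each of the two exceptional events. *)
have -> (u : R) : 2 * u = u + u by ring.
apply: lerD.
  apply: (@le_trans _ _ (expR 2 ^+ n * expR (- (3 * N%:R)))).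
    by rewrite ler_wpM2r ?expR_ge0// lerXn2r ?nnegrE ?expR_ge0// expR2_ge5.
  rewrite -expRM_natl -expRD ler_expR NE.
  have : expR ((1 - alpha) * L) <= expR L by rewrite ler_expR; nra.
  have : 1 <= expR L by rewrite -expR0 ler_expR; lra.
  have := nR; nra.
apply: (@le_trans _ _ (expR (20 + p / 2) ^+ n * expR (- (delta * N%:R / 4)))).
  rewrite ler_wpM2r ?expR_ge0//.
  have d0 : 0 < delta by exact: expR_gt0.
  have d1 : delta <= 1 by rewrite expR_le1; lra.
  rewrite lerXn2r// ?nnegrE ?expR_ge0//; first by rewrite addr_ge0// divr_ge0// ltW.
  have -> : expR (20 + p / 2) = expR 20 / delta by rewrite expRD /delta expRN invrK.
  rewrite ler_pdivlMr//.
  rewrite mulrDl mul1r divfK ?gt_eqF//.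
  apply: (@le_trans _ _ (1 + K)); first by lra.
  apply: (le_trans K20).
  have -> : (20 : R) = 20%:R * 1 by rewrite mulr1.
  by rewrite expRM_natl lerXn2r// ?nnegrE ?expR_ge0// expR1_ge2.
rewrite -expRM_natl -expRD ler_expR.
have := failure_exponent a01 L160; rewrite -pE -/delta NE => h.
have : n%:R * (20 + p / 2 + expR ((1 - alpha) * L) / 16) <=
  n%:R * (delta * expR L / 4) by rewrite ler_pM2l.
lra.
Qed.

End numerics.

Theorem theorem3p4 (R : realType) :
  exists (c1 c2 : R) (c0 : R -> R),
    [/\ 0 < c1, 0 < c2 &
     forall (n : nat) (d : measure_display) (Omega : measurableType d)
       (P : probability Omega R) (X : {RV P >-> 'rV[R]_n}),
       (0 < n)%N ->
       symmetric_rvec P X -> nondegenerate_rvec P X -> log_concave P X ->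
     forall (alpha : R) (N : nat) (Xs : 'I_N -> {RV P >-> 'rV[R]_n}),
       0 < alpha < 1 ->
       c0 alpha * n%:R <= N%:R ->
       (forall i, identically_distributed P (Xs i) X) ->
       mutually_independent P (fun i => Xs i : Omega -> 'rV[R]_n) ->
     let p := alpha * ln (expR 1 * N%:R / n%:R) in
     with_prob_at_least P
       (1 - 2 * expR (- (c1 * N%:R `^ (1 - alpha) * n%:R `^ alpha)))
       [set w | [set c2 *: z | z in centroid_body P X p] `<=`
                absconv (fun i => Xs i w)]].
Proof.
(* The rate [16^-1] comes from [failure_exponent]; [384 = 4 * 96], with one factor 2 for the
   small-ball bound and one for the passage from the net to all directions. *)
exists 16^-1, 384^-1, (fun alpha => expR (160 + alpha^-1)).
split; [by rewrite invr_gt0 ltr0n..|].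
move=> n d Omega P X n0 sX ndX lX alpha N Xs a01 nN idX indep p.
have [N0 p1 fail] := failure_probability n0 a01 nN.
(* The complement of the measurable exceptional set [B] is the witness inside the inclusion
   event. *)
have [B [mB PB QB]] := uniform_large_deviation sX lX ndX p1 n0 idX indep.
exists (~` B); split; first exact: measurableC.
- move=> w nB; apply: (centroid_body_sub_absconv sX lX ndX p1 _ N0).
    by rewrite invr_ge0 ler0n.
  exact: QB.
- rewrite probability_setC// EFinB leeB//.
  by apply: le_trans PB _; rewrite lee_fin.
Qed.
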